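(* Let $q$ be a prime power, let $s\ge 1$ be an integer, let $F$ be a global function field with full constant field $\mathbb{F}_q$ and genus $g$, and let $P_\infty,P_1,\ldots,P_s$ be $s+1$ distinct places of $F$ with $\deg(P_\infty)=1$. Put $e_i=\deg(P_i)$ for $1\le i\le s$. Then the matrices $C^{(1)},\ldots,C^{(s)}\in\mathbb{F}_q^{\mathbb{N}\times\mathbb{N}_0}$ given by the columnwise construction (described in the context) from $F,P_\infty,P_1,\ldots,P_s$ generate, by the digital method, a $(t,s)$-sequence in base $q$ with quality parameter $t=g+\sum_{i=1}^s(e_i-1)$.
   Context: **Columnwise construction.** For a divisor $D$ of $F$ let $\mathcal{L}(D)=\{f\in F^*:\mathrm{div}(f)+D\ge 0\}\cup\{0\}$ be the Riemann-Roch space and $\ell(D)$ its dimension over $\mathbb{F}_q$. The gap numbers of $P_\infty$ are the $g$ positive integers $n$ with $\ell(nP_\infty)=\ell((n-1)P_\infty)$. Let $n_0<n_1<n_2<\cdots$ be the elements of $\mathbb{N}_0$ that are not gap numbers of $P_\infty$, in increasing order. For each $r\ge 0$ choose any $y_r\in\mathcal{L}(n_rP_\infty)\setminus\mathcal{L}((n_r-1)P_\infty)$. For $1\le i\le s$ choose a local parameter $z_i$ at $P_i$ (i.e. $\nu_{P_i}(z_i)=1$); since $\nu_{P_i}(y_r)\ge 0$, the local expansion of $y_r$ at $P_i$ is $y_r=\sum_{k=0}^\infty\beta^{(i)}_{k,r}z_i^k$ with $\beta^{(i)}_{k,r}\in\mathbb{F}_{q^{e_i}}$ (the residue class field of $P_i$;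 the expansion takes place in the completion of $F$ at $P_i$, identified with $\mathbb{F}_{q^{e_i}}((z_i))$). Using a fixed ordered basis of $\mathbb{F}_{q^{e_i}}/\mathbb{F}_q$, identify $\beta^{(i)}_{k,r}$ with a column vector $\boldsymbol{b}^{(i)}_{k,r}\in\mathbb{F}_q^{e_i}$. Column $r$ ($r\ge 0$) of $C^{(i)}=(c^{(i)}_{j,r})_{j\ge1,r\ge0}$ is the concatenation of $\boldsymbol{b}^{(i)}_{0,r},\boldsymbol{b}^{(i)}_{1,r},\boldsymbol{b}^{(i)}_{2,r},\ldots$; i.e. $c^{(i)}_{ke_i+h,r}$ is the $h$th coordinate of $\boldsymbol{b}^{(i)}_{k,r}$ for $k\ge0$, $1\le h\le e_i$. **Digital method.** Let $Z_q=\{0,1,\ldots,q-1\}\subset\mathbb{Z}$. Choose bijections $\psi_r:Z_q\to\mathbb{F}_q$ ($r\ge0$) with $\psi_r(0)=0$ for all sufficiently large $r$, and bijections $\lambda_{i,j}:\mathbb{F}_q\to Z_q$ ($1\le i\le s$, $j\ge1$); these choices are arbitrary. For $n\ge0$ with base-$q$ expansion $n=\sum_{r\ge0}z_r(n)q^r$, put $y^{(i)}_{n,j}=\sum_{r\ge0}c^{(i)}_{j,r}\psi_r(z_r(n))\in\mathbb{F}_q$ and $x^{(i)}_n=\sum_{j\ge1}\lambda_{i,j}(y^{(i)}_{n,j})q^{-j}$. The sequence generated by $C^{(1)},\ldots,C^{(s)}$ is $\boldsymbol{x}_n=(x_n^{(1)},\ldots,x_n^{(s)})$, $n\ge0$.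 **$(t,s)$-sequences.** Points are counted with multiplicity. For integers $b\ge2$, $0\le t\le m$, a *$(t,m,s)$-net in base $b$* is a point set of $b^m$ points in $[0,1)^s$ such that every interval $\prod_{i=1}^s[a_ib^{-d_i},(a_i+1)b^{-d_i})$ with integers $d_i\ge0$, $0\le a_i<b^{d_i}$ and volume $b^{t-m}$ contains exactly $b^t$ of the points. A sequence $\boldsymbol{x}_0,\boldsymbol{x}_1,\ldots$ in $[0,1]^s$ is a *$(t,s)$-sequence in base $b$* ($t\ge0$ an integer) if for all integers $k\ge0$ and $m>t$ the points $[\boldsymbol{x}_n]_{b,m}$, $kb^m\le n<(k+1)b^m$, form a $(t,m,s)$-net in base $b$. Here $[\boldsymbol{x}_n]_{b,m}$ is the coordinatewise $m$-digit truncation in base $b$, taken with respect to the given digit expansion of each coordinate (for the digital method: $\sum_{j\ge1}\lambda_{i,j}(y^{(i)}_{n,j})q^{-j}$ is truncated to $\sum_{j=1}^m$). *)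

(* Defs.v *)
(* MathComp world, with MathComp-Analysis for the classical reasoning and for
   the real coordinates of the points. *)
From HB Require Import structures.
From mathcomp Require Import all_boot all_order all_algebra all_field.
From mathcomp Require Import all_classical all_reals all_analysis.
From mathcomp Require Import freeg.

Set Implicit Arguments.
Unset Strict Implicit.
Unset Printing Implicit Defensive.

Import Order.TTheory GRing.Theory Num.Theory.
Import numFieldNormedType.Exports.

Local Open Scope classical_set_scope.
Local Open Scope ring_scope.

(* Normalized discrete valuations.  The value +oo at 0 is not represented:
   [dval 0] is the dummy 0, which makes equality of valuations as records
   coincide with equality on nonzero elements.  Inequalities on values go
   through [val_ge], where 0 has value +oo. *)
Record discrete_valuation (L : fieldType) := DiscreteValuation {
  dval :> L -> int;
  dval0 : dval 0 = 0;
  dvalM : forall x y, x != 0 -> y != 0 -> dval (x * y) = dval x + dval y;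
  dvalD : forall x y, x != 0 -> y != 0 -> x + y != 0 ->
    Num.min (dval x) (dval y) <= dval (x + y);
  dval_onto : forall n : int, exists2 x, x != 0 & dval x = n }.

Definition val_ge (L : fieldType) (v : discrete_valuation L) (n : int) (x : L) :=
  (x == 0) || (n <= v x).

Definition val_converges (L : fieldType) (v : discrete_valuation L)
    (u : nat -> L) (l : L) :=
  forall N : nat, exists n0, forall n, (n0 <= n)%N -> val_ge v N%:Z (u n - l).

Definition val_cauchy (L : fieldType) (v : discrete_valuation L) (u : nat -> L) :=
  forall N : nat, exists n0, forall m n, (n0 <= m)%N -> (n0 <= n)%N ->
    val_ge v N%:Z (u m - u n).

(* Completions are given by their characterization up to isomorphism. *)
Record completion (L : fieldType) (v : discrete_valuation L) := Completion {
  comp_field :> fieldType;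
  comp_emb : {rmorphism L -> comp_field};
  comp_val : discrete_valuation comp_field;
  comp_valE : forall x, comp_val (comp_emb x) = v x;
  comp_dense : forall w, exists u : nat -> L,
    val_converges comp_val (fun n => comp_emb (u n)) w;
  comp_complete : forall u, val_cauchy comp_val u ->
    exists w, val_converges comp_val u w }.

Section FunctionField.
Variables (K F : fieldType) (iota : {rmorphism K -> F}).

(* F is a finite extension of K(x) for some x transcendental over K, an element
   of K(x) being written p(x) / q(x). *)
Definition function_field := exists2 x : F, ~ algebraicOver iota x &
  exists n (b : 'I_n -> F), forall f, exists p q : 'I_n -> {poly K},
    (forall i, q i != 0) /\
    f = \sum_(i < n)
          (map_poly iota (p i)).[x] / (map_poly iota (q i)).[x] * b i.

Definition full_constant_field :=
  forall a : F, algebraicOver iota a -> exists c, a = iota c.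

Record place := Place {
  place_val :> discrete_valuation F;
  place_triv : forall c, c != 0 -> place_val (iota c) = 0 }.

HB.instance Definition _ := gen_eqMixin place.
HB.instance Definition _ := gen_choiceMixin place.

(* [V / W] has dimension n over K, for K-subspaces W of V of F: the family b
   induces a basis of the quotient. *)
Definition has_dim (V W : set F) (n : nat) := exists b : 'I_n -> F,
  [/\ forall i, V (b i),
      forall c : 'I_n -> K,
        W (\sum_(i < n) iota (c i) * b i) -> forall i, c i = 0
    & forall v, V v -> exists c : 'I_n -> K,
        W (v - \sum_(i < n) iota (c i) * b i)].

(* Dummy value 0 when the quotient has infinite dimension. *)
Definition dim (V W : set F) : nat := xget 0%N [set n | has_dim V W n].

(* Degree over K of the residue class field. *)
Definition degree (P : place) : nat :=
  dim [set f | val_ge P 0 f] [set f | val_ge P 1 f].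

Definition divisor := {freeg place / int}.

Definition divisor_degree (D : divisor) : int :=
  \sum_(P <- dom D) coeff P D * (degree P)%:Z.

Definition riemann_roch (D : divisor) : set F :=
  [set f | f = 0 \/ forall P : place, 0 <= P f + coeff P D].

Definition ell (D : divisor) : nat := dim (riemann_roch D) [set 0].

(* g is the maximum of deg D - l(D) + 1 over all divisors D. *)
Definition has_genus (g : nat) :=
  (exists D, divisor_degree D - (ell D)%:Z + 1 = g%:Z) /\
  (forall D, divisor_degree D - (ell D)%:Z + 1 <= g%:Z).

Definition gap_number (P : place) (n : nat) :=
  (0 < n)%N /\ ell << n%:Z *g P >> = ell << (n%:Z - 1) *g P >>.

Definition nongap_enumeration (P : place) (nn : nat -> nat) :=
  {homo nn : r r' / (r < r')%N} /\
  range nn = [set n | ~ gap_number P n].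

(* An identification, inside a completion Fh of F, of E with the residue class
   field: a K-embedding tau of E in the valuation ring such that each residue
   class contains exactly one tau a.  The elements of Fh are then the Laurent
   series over E in a local parameter. *)
Record coefficient_field (P : place) (Fh : completion P) (E : fieldExtType K) :=
  CoefficientField {
    cf_emb :> {rmorphism E -> Fh};
    cf_const : forall c : K, cf_emb c%:A = comp_emb Fh (iota c);
    cf_int : forall a, val_ge (comp_val Fh) 0 (cf_emb a);
    cf_residue : forall w, val_ge (comp_val Fh) 0 w ->
      exists! a, val_ge (comp_val Fh) 1 (w - cf_emb a) }.

(* y = \sum_(k >= 0) beta_k z ^ k in the completion *)
Definition local_expansion (P : place) (Fh : completion P) (E : fieldExtType K)
    (tau : coefficient_field Fh E) (z y : F) (beta : nat -> E) :=
  val_converges (comp_val Fh)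
    (fun N => \sum_(k < N) tau (beta k) * comp_emb Fh z ^+ k) (comp_emb Fh y).

End FunctionField.

(* Rows of a generating matrix, and digits, are numbered from 0: row j is the
   (j + 1)-st row, and digit j has weight b ^ -(j + 1). *)
Section DigitalMethod.
Variables (K : finFieldType) (s : nat).

Lemma card_field_gt0 : (0 < #|K|)%N.
Proof. exact: ltnW (finNzRing_gt1 K). Qed.

(* the base-#|K| digit z_r(n) *)
Definition base_digit (n r : nat) : 'I_#|K| :=
  Ordinal (ltn_pmod (n %/ #|K| ^ r) card_field_gt0).

(* The sum over r has finite support as soon as psi r 0 = 0 for large r. *)
Definition digital_coord (C : 'I_s -> nat -> nat -> K) (psi : nat -> 'I_#|K| -> K)
    (n : nat) (i : 'I_s) (j : nat) : K :=
  \sum_(r \in [set: nat]) C i j r * psi r (base_digit n r).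

Definition digital_digits (C : 'I_s -> nat -> nat -> K) (psi : nat -> 'I_#|K| -> K)
    (lambda : 'I_s -> nat -> K -> 'I_#|K|) (n : nat) (i : 'I_s) (j : nat) : 'I_#|K| :=
  lambda i j (digital_coord C psi n i j).

End DigitalMethod.

Section Nets.
Variable R : realType.

Definition digit_term (b : nat) (d : nat -> 'I_b) (j : nat) : R :=
  (d j)%:R / b%:R ^+ j.+1.

Definition digit_value (b : nat) (d : nat -> 'I_b) : R :=
  limn (series (digit_term d)).

Definition truncation (b m : nat) (d : nat -> 'I_b) : R :=
  \sum_(j < m) digit_term d j.

Definition in_interval (b s : nat) (d a : 'I_s -> nat) (x : 'I_s -> R) : bool :=
  [forall i, (a i)%:R / b%:R ^+ d i <= x i < (a i).+1%:R / b%:R ^+ d i].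

(* A point set counted with multiplicity is a family indexed by 'I_(b ^ m). *)
Definition net (b t m s : nat) (x : 'I_(b ^ m) -> 'I_s -> R) :=
  [/\ (2 <= b)%N, (t <= m)%N,
      forall n i, 0 <= x n i < 1
    & forall d a : 'I_s -> nat,
        (forall i, (a i < b ^ d i)%N) ->
        \prod_(i < s) (b%:R ^+ d i)^-1 = b%:R ^- (m - t) :> R ->
        #|[pred n | in_interval b d a (x n)]| = (b ^ t)%N].

(* The expansion [dig n i] of each coordinate [x n i] is part of the data. *)
Definition ts_sequence (b t s : nat) (x : nat -> 'I_s -> R)
    (dig : nat -> 'I_s -> nat -> 'I_b) :=
  [/\ (2 <= b)%N,
      forall n i, 0 <= x n i <= 1,
      forall n i, series (digit_term (dig n i)) @ \oo --> x n i
    & forall k m, (t < m)%N ->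
        net t (fun (n : 'I_(b ^ m)) i => truncation m (dig (k * b ^ m + n)%N i))].

Definition digital_sequence (K : finFieldType) (s : nat)
    (C : 'I_s -> nat -> nat -> K) (psi : nat -> 'I_#|K| -> K)
    (lambda : 'I_s -> nat -> K -> 'I_#|K|) (n : nat) (i : 'I_s) : R :=
  digit_value (digital_digits C psi lambda n i).

End Nets.

(* Main.v *)
(* Write P for the rational place and delta D = l(D) - deg D - 1 + g, which is
   nonnegative by the definition of the genus.  The core is the part of the
   Riemann-Roch theorem saying that delta D = 0 as soon as deg D >= 2g - 1.  As
   the genus is only given as a maximum, neither the product formula nor duality
   is available.  The vanishing of delta (D + nP) for large n is carried over
   from a divisor attaining the maximum to all others, one place at a time; a
   dimension count in F / (V + O), the first cohomology of D, then replaces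
   duality.

   Given m > t, the divisor nP with n = m - 1 + g is nonspecial, so y_0, ...,
   y_(m-1) form a basis of L(nP).  With k_i = ceil(d_i / e_i), the combinations
   killed by the first k_i e_i rows of each C^(i) lie in L(nP - sum_i k_i P_i),
   which is still nonspecial: these rows, hence the first d_i, are linearly
   independent.  An elementary interval of volume q^(t-m) prescribes exactly these
   m - t digits, so its points correspond to a coset of a t-dimensional space. *)
Require Import Defs.
From HB Require Import structures.
From mathcomp Require Import all_boot all_order all_algebra all_field.
From mathcomp Require Import all_classical all_reals all_analysis.
From mathcomp Require Import freeg.
From mathcomp Require Import zify ring.

Set Implicit Arguments.
Unset Strict Implicit.
Unset Printing Implicit Defensive.

Import Order.TTheory GRing.Theory Num.Theory.
Import numFieldNormedType.Exports.

Local Open Scope ring_scope.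

(** * Linear algebra in quotients V / W of K-subspaces of F *)

Section QuotientDimension.
Variables (K F : fieldType) (iota : {rmorphism K -> F}).

Definition subspace (V : set F) :=
  V 0 /\ forall c x y, V x -> V y -> V (iota c * x + y).

Definition setsum (U W : set F) : set F :=
  [set x | exists u w, [/\ U u, W w & x = u + w]].

(** The two halves of [has_dim], kept apart because dimensions are compared by playing a spanning
    family against an independent one. *)
Definition spanning (V W : set F) n (b : 'I_n -> F) :=
  forall v, V v -> exists c : 'I_n -> K, W (v - \sum_(i < n) iota (c i) * b i).

Definition independent (V W : set F) n (b : 'I_n -> F) :=
  (forall i, V (b i)) /\
  forall c : 'I_n -> K, W (\sum_(i < n) iota (c i) * b i) -> forall i, c i = 0.

Lemma has_dimP V W n :
  has_dim iota V W n <-> exists b : 'I_n -> F, independent V W b /\ spanning V W b.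
Proof.
split=> [[b [Vb fb sb]]|[b [[Vb fb] sb]]]; exists b => //.
Qed.

Lemma subspaceD V x y : subspace V -> V x -> V y -> V (x + y).
Proof. by case=> _ VP Vx Vy; have := VP 1 _ _ Vx Vy; rewrite rmorph1 mul1r. Qed.

Lemma subspaceZ V c x : subspace V -> V x -> V (iota c * x).
Proof. by case=> V0 VP Vx; have := VP c _ _ Vx V0; rewrite addr0. Qed.

Lemma subspaceN V x : subspace V -> V x -> V (- x).
Proof.
by move=> sV Vx; have := subspaceZ (-1) sV Vx; rewrite rmorphN1 mulN1r.
Qed.

Lemma subspaceB V x y : subspace V -> V x -> V y -> V (x - y).
Proof. by move=> sV Vx Vy; apply: subspaceD => //; exact: subspaceN. Qed.

Lemma subspace_sum V n (f : 'I_n -> F) :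
  subspace V -> (forall i, V (f i)) -> V (\sum_(i < n) f i).
Proof.
move=> sV Vf; elim/big_ind: _ => //; first by case: sV.
by move=> x y; exact: subspaceD.
Qed.

Lemma subspace_comb V n (c : 'I_n -> K) (b : 'I_n -> F) :
  subspace V -> (forall i, V (b i)) -> V (\sum_(i < n) iota (c i) * b i).
Proof. by move=> sV Vb; apply: subspace_sum => // i; exact: subspaceZ. Qed.

Lemma subspace0 : subspace [set 0].
Proof. by split=> // c x y -> ->; rewrite mulr0 addr0. Qed.

Lemma subspace_setsum U W : subspace U -> subspace W -> subspace (setsum U W).
Proof.
move=> sU sW; split; first by exists 0, 0; case: sU sW => ? _ [? _]; rewrite addr0.
move=> c x y [u [w [Uu Ww ->]]] [u' [w' [Uu' Ww' ->]]].
exists (iota c * u + u'), (iota c * w + w'); split.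
- by case: sU => _; exact.
- by case: sW => _; exact.
- by rewrite mulrDr addrACA.
Qed.

Lemma setsuml U W x : subspace W -> U x -> setsum U W x.
Proof. by case=> W0 _ Ux; exists x, 0; rewrite addr0. Qed.

Lemma setsumr U W x : subspace U -> W x -> setsum U W x.
Proof. by case=> U0 _ Wx; exists 0, x; rewrite add0r. Qed.

Lemma underdetermined m n (a : 'I_m -> 'I_n -> K) : (n < m)%N ->
  exists2 u : 'I_m -> K, exists i, u i != 0 &
    forall j, \sum_(i < m) u i * a i j = 0.
Proof.
move=> ltnm; pose A := \matrix_(i < m, j < n) a i j.
have : (kermx A != 0)%R.
  rewrite kermx_eq0 /row_free; apply/negP=> /eqP rA.
  by have := rank_leq_col A; rewrite rA leqNgt ltnm.
case/rowV0Pn=> u /sub_kermxP uA0 u0.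
exists (fun i => u 0 i).
  apply/existsP; apply: contraNT u0; rewrite negb_exists => /forallP u0.
  by apply/eqP/rowP=> i; rewrite mxE; apply/eqP; rewrite -[_ == _]negbK.
move=> j; have /rowP/(_ j) := uA0; rewrite !mxE => uj; rewrite -[RHS]uj.
by apply: eq_bigr => i _; rewrite mxE.
Qed.

(** Modulo W each [c i] is a combination of the [b j]; a nonzero vector in the left kernel of the
    coefficient matrix gives the relation. *)
Lemma steinitz V W n m (b : 'I_n -> F) (c : 'I_m -> F) :
  subspace W -> spanning V W b -> (forall i, V (c i)) -> (n < m)%N ->
  exists2 u : 'I_m -> K, exists i, u i != 0 & W (\sum_(i < m) iota (u i) * c i).
Proof.
move=> sW sb Vc ltnm.
have /choice[a aP] : forall i, exists a : 'I_n -> K,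
  W (c i - \sum_(j < n) iota (a j) * b j) by move=> i; exact: sb.
have [u u0 ua] := underdetermined a ltnm; exists u => //.
have -> : \sum_(i < m) iota (u i) * c i =
    \sum_(i < m) iota (u i) * (c i - \sum_(j < n) iota (a i j) * b j).
  under [RHS]eq_bigr do rewrite mulrBr mulr_sumr.
  rewrite sumrB exchange_big /= [X in _ - X]big1 ?subr0 // => j _.
  under eq_bigr do rewrite mulrA -rmorphM.
  by rewrite -mulr_suml -rmorph_sum ua rmorph0 mul0r.
by apply: subspace_sum => // i; apply: subspaceZ.
Qed.

Lemma independent_le V W n m (b : 'I_n -> F) (c : 'I_m -> F) :
  subspace W -> spanning V W b -> independent V W c -> (m <= n)%N.
Proof.
move=> sW sb [Vc fc]; rewrite leqNgt; apply/negP => ltnm.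
by have [u [i /eqP u0] Wu] := steinitz sW sb Vc ltnm; apply: u0; exact: fc.
Qed.

Lemma has_dim_uniq V W n m :
  subspace W -> has_dim iota V W n -> has_dim iota V W m -> n = m.
Proof.
move=> sW /has_dimP[b [fb sb]] /has_dimP[c [fc sc]]; apply/eqP.
by rewrite eqn_leq (independent_le sW sc fb) (independent_le sW sb fc).
Qed.

Lemma dimE V W n : subspace W -> has_dim iota V W n -> Defs.dim iota V W = n.
Proof.
by move=> sW Vn; apply: xget_unique => // m Vm; exact: has_dim_uniq Vm Vn.
Qed.

(** The dummy value of [dim] is 0, so a positive value certifies a genuine basis. *)
Lemma dim_neq0 V W n : Defs.dim iota V W = n.+1 -> has_dim iota V W n.+1.
Proof.
rewrite /Defs.dim.
by case: (@xgetP _ 0%N [set n | has_dim iota V W n]) => [k _ Hk kn|]; rewrite -?kn.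
Qed.

(** An independent family of maximal length is a basis, since a vector outside its span could be
    adjoined to it. *)
Lemma has_dim_exists V W N :
  subspace V -> subspace W ->
  (forall m (b : 'I_m -> F), independent V W b -> (m <= N)%N) ->
  exists2 n, (n <= N)%N & has_dim iota V W n.
Proof.
move=> sV sW bnd.
pose Q n := `[< exists b : 'I_n -> F, independent V W b >].
have Q0 : exists n, Q n.
  by exists 0%N; apply/asboolP; exists (fun=> 0); split => [[]|? _ []].
have QN n : Q n -> (n <= N)%N by move=> /asboolP[b]; exact: bnd.
case: (ex_maxnP Q0 QN) => n Qn nmax; exists n; first exact: QN.
have [b fb] := asboolP _ Qn; apply/has_dimP; exists b; split=> // v Vv.
apply: contrapT => nv.
have : Q n.+1.
  apply/asboolP.
  exists (fun i => if unlift ord0 i is Some j then b j else v); split.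
    by move=> i; case: unlift => // j; case: fb.
  move=> c; rewrite big_ord_recl unlift_none.
  under eq_bigr do rewrite liftK.
  move=> Wc.
  have c0 : c ord0 = 0.
    apply/eqP; apply: contra_notT nv => c0.
    exists (fun i => - c (fintype.lift ord0 i) / c ord0).
    have := subspaceZ (c ord0)^-1 sW Wc.
    rewrite mulrDr mulrA -rmorphM mulVf // rmorph1 mul1r mulr_sumr -sumrN.
    congr (W (_ + _)); apply: eq_bigr => i _.
    by rewrite mulrA -rmorphM -mulNr -rmorphN; congr (iota _ * _); rewrite mulNr opprK mulrC.
  move=> i; case: (unliftP ord0 i) => [j ->|-> //].
  by move: Wc; rewrite c0 rmorph0 mul0r add0r; case: fb => _ /[apply]; exact.
by move=> /nmax; rewrite ltnn.
Qed.

Lemma has_dimD V U W a b :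
  subspace W -> subspace U -> (W `<=` U)%classic -> (U `<=` V)%classic ->
  has_dim iota V U a -> has_dim iota U W b -> has_dim iota V W (a + b).
Proof.
move=> sW sU WU UV [v [Vv fv sv]] [u [Uu fu su]].
pose t i := match fintype.split i with inl j => v j | inr j => u j end.
have tE (c : 'I_(a + b) -> K) : \sum_(i < a + b) iota (c i) * t i =
   \sum_(i < a) iota (c (lshift b i)) * v i + \sum_(i < b) iota (c (rshift a i)) * u i.
  rewrite big_split_ord /=; congr (_ + _); apply: eq_bigr => i _.
    by rewrite /t (unsplitK (inl i)).
  by rewrite /t (unsplitK (inr i)).
exists t; split.
- by move=> i; rewrite /t; case: fintype.split => j //; apply: UV.
- move=> c; rewrite tE => Wc.
  have c1 : forall i, c (lshift b i) = 0.
    apply: (fv (fun i => c (lshift b i))).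
    rewrite -[X in U X](addrK (\sum_(i < b) iota (c (rshift a i)) * u i)).
    by apply: subspaceB (WU _ Wc) _ => //; exact: subspace_comb.
  move: Wc; rewrite big1 => [|i _]; last by rewrite c1 rmorph0 mul0r.
  rewrite add0r => /(fu (fun i => c (rshift a i))) c2 i.
  by rewrite -(splitK i); case: fintype.split.
- move=> x Vx; have [c Uc] := sv _ Vx; have [d Wd] := su _ Uc.
  exists (fun i => match fintype.split i with inl j => c j | inr j => d j end).
  rewrite tE opprD addrA; congr W: Wd; congr (_ - _ - _); apply: eq_bigr => i _.
    by rewrite (unsplitK (inl i)).
  by rewrite (unsplitK (inr i)).
Qed.

(** A family independent in V / U or in U / W is also independent in V / W, so n bounds its length
    and both quotients have bases. *)
Lemma has_dim_sub V U W n :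
  subspace V -> subspace U -> subspace W -> (W `<=` U)%classic -> (U `<=` V)%classic ->
  has_dim iota V W n -> exists a b,
    [/\ has_dim iota V U a, has_dim iota U W b & (a + b)%N = n].
Proof.
move=> sV sU sW WU UV Vn; have [b [_ sb]] := (has_dimP V W n).1 Vn.
have [a _ Ha] : exists2 a, (a <= n)%N & has_dim iota V U a.
  apply: has_dim_exists => // m c [Vc fc]; apply: (independent_le sW sb).
  by split=> [//|d /WU]; exact: fc.
have [b' _ Hb] : exists2 a, (a <= n)%N & has_dim iota U W a.
  apply: has_dim_exists => // m c [Uc fc]; apply: (independent_le sW sb).
  by split=> [i|]; [apply: UV; exact: Uc | exact: fc].
exists a, b'; split=> //; apply: has_dim_uniq Vn => //; exact: has_dimD Ha Hb.
Qed.

(** Multiplication by [a] sends V into V' and, within V, only elements of W into W', so no new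
    relation appears. *)
Lemma independent_map V W V' W' (a : F) n (b : 'I_n -> F) :
  subspace V -> (forall x, V x -> V' (a * x)) ->
  (forall x, V x -> W' (a * x) -> W x) ->
  independent V W b -> independent V' W' (fun i => a * b i).
Proof.
move=> sV VV WW [Vb fb]; split=> [i|c Wc]; first exact: VV.
apply: fb; apply: WW; first exact: subspace_comb.
rewrite mulr_sumr; congr W': Wc.
by apply: eq_bigr => i _; rewrite mulrCA.
Qed.

(** Second isomorphism theorem. *)
Lemma has_dim_setsum V W n : subspace V -> subspace W ->
  has_dim iota V (V `&` W)%classic n -> has_dim iota (setsum W V) W n.
Proof.
move=> sV sW [b [Vb fb sb]]; exists b; split.
- by move=> i; exact: setsumr.
- by move=> c Wc; apply: fb; split=> //; exact: subspace_comb.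
move=> _ [w [v [Ww Vv ->]]]; have [c [_ Wc]] := sb _ Vv.
by exists c; rewrite -addrA; exact: subspaceD.
Qed.

End QuotientDimension.

(** * Elementary properties of discrete valuations *)

Section Valuations.
Variables (L : fieldType) (v : discrete_valuation L).

Lemma dval1 : v 1 = 0.
Proof. by have := dvalM v (oner_neq0 L) (oner_neq0 L); rewrite mulr1; move: (v 1) => n; lia. Qed.

Lemma dvalN x : v (- x) = v x.
Proof.
have [->|x0] := eqVneq x 0; first by rewrite oppr0.
have N1 : -1 != 0 :> L by rewrite oppr_eq0 oner_neq0.
have := dvalM v N1 N1; rewrite mulrNN mulr1 dval1 => vN1.
by rewrite -mulN1r dvalM //; lia.
Qed.

Lemma dvalV x : x != 0 -> v x^-1 = - v x.
Proof.
by move=> x0; have := dvalM v x0 (invr_neq0 x0); rewrite divff // dval1; lia.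
Qed.

Lemma dvalX x n : x != 0 -> v (x ^+ n) = v x * n%:Z.
Proof.
move=> x0; elim: n => [|n IH]; first by rewrite expr0 dval1 mulr0.
by rewrite exprS dvalM ?expf_neq0 // IH; lia.
Qed.

Lemma val_ge0 n : val_ge v n 0.
Proof. by rewrite /val_ge eqxx. Qed.

Lemma val_geE n x : x != 0 -> val_ge v n x = (n <= v x).
Proof. by rewrite /val_ge => /negbTE ->. Qed.

Lemma val_ge_le m n x : m <= n -> val_ge v n x -> val_ge v m x.
Proof. by rewrite /val_ge => mn /orP[->//|nx]; rewrite (le_trans mn nx) orbT. Qed.

Lemma val_geD n x y : val_ge v n x -> val_ge v n y -> val_ge v n (x + y).
Proof.
have [->|x0] := eqVneq x 0; first by rewrite add0r.
have [->|y0] := eqVneq y 0; first by rewrite addr0.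
have [->|xy0] := eqVneq (x + y) 0; first by rewrite val_ge0.
rewrite !val_geE // => nx ny; apply: le_trans (dvalD v x0 y0 xy0).
by rewrite le_min nx ny.
Qed.

Lemma val_geN n x : val_ge v n x -> val_ge v n (- x).
Proof. by rewrite /val_ge oppr_eq0 dvalN. Qed.

Lemma val_geB n x y : val_ge v n x -> val_ge v n y -> val_ge v n (x - y).
Proof. by move=> nx ny; apply: val_geD => //; exact: val_geN. Qed.

Lemma val_geM m n x y : val_ge v m x -> val_ge v n y -> val_ge v (m + n) (x * y).
Proof.
have [->|x0] := eqVneq x 0; first by rewrite mul0r !val_ge0.
have [->|y0] := eqVneq y 0; first by rewrite mulr0 !val_ge0.
by rewrite !val_geE ?mulf_neq0 // dvalM //; lia.
Qed.

Lemma val_ge_sum n k (f : 'I_k -> L) :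
  (forall i, val_ge v n (f i)) -> val_ge v n (\sum_(i < k) f i).
Proof.
move=> fn; apply: (big_ind (val_ge v n)) => [|x y|i _]; [exact: val_ge0|exact: val_geD|exact: fn].
Qed.

End Valuations.

(** * Riemann-Roch spaces, degrees and the filtration at a place *)

Section Divisors.
Variables (K F : fieldType) (iota : {rmorphism K -> F}).
Implicit Types (Q P : place iota) (D E : divisor iota).
Local Notation "''L' D" := (riemann_roch D) (at level 8, D at level 8).
Local Notation has_dim := (has_dim iota).
Local Notation subspace := (subspace iota).

Definition val_space Q (n : int) : set F := [set f | val_ge Q n f].

Lemma val_ge_iota Q c : val_ge Q 0 (iota c).
Proof.
have [->|c0] := eqVneq c 0; first by rewrite rmorph0 val_ge0.
by rewrite /val_ge place_triv // lexx orbT.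
Qed.

Lemma subspace_val Q n : subspace (val_space Q n).
Proof.
split=> [|c x y xn yn]; first exact: val_ge0.
by apply: val_geD => //; rewrite -[n]add0r; apply: val_geM => //; exact: val_ge_iota.
Qed.

(** With [val_ge], for which 0 has value +oo, the case f = 0 is absorbed into the local
    conditions. *)
Lemma riemann_rochP Q D f :
  'L D f <-> forall P, val_ge P (- coeff P D) f.
Proof.
split=> [[->|Df] P|Df]; first exact: val_ge0.
  by rewrite /val_ge; have := Df P; rewrite -lerBlDr sub0r => ->; rewrite orbT.
have [->|f0] := eqVneq f 0; first by left.
by right=> P; have := Df P; rewrite val_geE // -lerBlDr sub0r.
Qed.

Lemma subspace_rr D : subspace ('L D).
Proof.
split=> [|c x y Dx Dy]; first by left.
have [->|cxy0] := eqVneq (iota c * x + y) 0; first by left.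
right=> P; move: (conj Dx Dy); rewrite !(riemann_rochP P) => -[/(_ P) xP /(_ P) yP].
have [_ /(_ c _ _ xP yP)] := subspace_val P (- coeff P D).
by rewrite /val_space /= val_geE // -subr_ge0 opprK.
Qed.

Lemma rr_sub D E : (forall P, coeff P D <= coeff P E) -> ('L D `<=` 'L E)%classic.
Proof.
move=> DE f [->|Df]; [by left|right=> P].
by apply: le_trans (Df P) _; rewrite lerD2l.
Qed.

Lemma divisor_degreeE D :
  divisor_degree D = fglift (fun P => (degree P)%:Z : int^o) D.
Proof.
rewrite -[D in RHS]Freeg_dom fglift_Freeg /prelift big_map.
by [].
Qed.

Lemma divisor_degreeB D E : divisor_degree (D - E) = divisor_degree D - divisor_degree E.
Proof. by rewrite !divisor_degreeE lift_is_additive. Qed.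

Lemma divisor_degreeN D : divisor_degree (- D) = - divisor_degree D.
Proof. by rewrite -sub0r -(subrr D) !divisor_degreeB subrr sub0r. Qed.

Lemma divisor_degreeD D E : divisor_degree (D + E) = divisor_degree D + divisor_degree E.
Proof. by rewrite -[E in LHS]opprK divisor_degreeB divisor_degreeN opprK. Qed.

Lemma divisor_degreeU k P : divisor_degree << k *g P >> = k * (degree P)%:Z.
Proof. by rewrite divisor_degreeE liftU. Qed.

Lemma coeff_single (k : int) Q P :
  coeff P (<< k *g Q >> : divisor iota) = if Q == P then k else 0.
Proof. by rewrite coeffU; case: eqP; rewrite ?mulr1 ?mulr0. Qed.

Lemma coeff_add P D E : coeff P (D + E) = coeff P D + coeff P E :> int.
Proof. exact: coeffD. Qed.

Lemma coeff_opp P D : coeff P (- D) = - coeff P D :> int.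
Proof. exact: coeffN. Qed.

Definition coeffE := (coeff_add, coeff_opp, coeff_single).

(** Multiplication by an element of value n identifies the residue class field with the n-th graded
    piece at Q. *)
Lemma has_dim_val Q d n :
  has_dim (val_space Q 0) (val_space Q 1) d ->
  has_dim (val_space Q n) (val_space Q (n + 1)) d.
Proof.
move=> /has_dimP[b [ib sb]]; have [u u0 un] := dval_onto Q n.
have uVn : val_ge Q (- n) u^-1 by rewrite val_geE ?invr_neq0 // dvalV // un.
apply/has_dimP; exists (fun i => u * b i); split.
  apply: independent_map ib => [|x x0|x _ /= xn]; first exact: subspace_val.
    by rewrite /val_space /= -[n]addr0; apply: val_geM => //; rewrite val_geE // un.
  have := val_geM uVn xn; rewrite mulKf //; congr val_ge; lia.
move=> x xn; have [|c cP] := sb (u^-1 * x).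
  by have := val_geM uVn xn; rewrite addNr.
exists c; have := val_geM (_ : val_ge Q n u) cP.
rewrite mulrBr mulVKf // mulr_sumr => H.
rewrite /val_space /=; under eq_bigr do rewrite mulrCA.
by apply: H; rewrite val_geE // un.
Qed.

Lemma has_dim_val_tower Q n k :
  has_dim (val_space Q 0) (val_space Q 1) 1 ->
  has_dim (val_space Q (n - k%:Z)) (val_space Q n) k.
Proof.
move=> Q1; elim: k n => [|k IH] n.
  rewrite subr0; exists (fun=> 0); split=> [[]|? _ []|v Vv] //.
  by exists (fun=> 0); rewrite big_ord0 subr0.
rewrite -addn1; apply: (has_dimD (U := val_space Q (n - 1))) => //.
- exact: subspace_val.
- exact: subspace_val.
- by move=> x; apply: val_ge_le; lia.
- by move=> x; apply: val_ge_le; lia.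
- by have := IH (n - 1); congr (has_dim (val_space _ _)); lia.
- by have := has_dim_val (n - 1) Q1; rewrite subrK.
Qed.

End Divisors.

(** * Finiteness, and vanishing of delta far along P *)

Section Genus.
Variables (K F : fieldType) (iota : {rmorphism K -> F}) (g : nat) (P : place iota).
Hypotheses (F_genus : has_genus iota g) (degP : degree P = 1%N).
Implicit Types (Q R : place iota) (D E : divisor iota).
Local Notation "''L' D" := (riemann_roch D) (at level 8, D at level 8).
Local Notation has_dim := (has_dim iota).
Local Notation subspace := (subspace iota).
Local Notation "<[ n ]>" := (<< n%:Z *g P >> : divisor iota).

Lemma divisor_degreeP (k : int) : divisor_degree (<< k *g P >> : divisor iota) = k.
Proof. by rewrite divisor_degreeU degP mulr1. Qed.

Lemma has_dim_P : has_dim (val_space P 0) (val_space P 1) 1.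
Proof. exact: dim_neq0. Qed.

Lemma ell_genus D : divisor_degree D + 1 - g%:Z <= (ell D)%:Z.
Proof. have := F_genus.2 D; lia. Qed.

Lemma rr_sub_addP D n : ('L D `<=` 'L (D + <[n]>))%classic.
Proof. by apply: rr_sub => R; rewrite !coeffE; do ?case: eqP => _; lia. Qed.

(* An infinite-dimensional L(D) has ell D = 0 by convention, and then so has
   every L(D + nP), contradicting the bound defining the genus. *)
Lemma ell_fin D : has_dim ('L D) [set 0] (ell D).
Proof.
suff [n Dn] : exists n, has_dim ('L D) [set 0] n.
  by have -> : ell D = n by apply: dimE Dn; exact: subspace0.
apply: contrapT => nD.
pose N := (absz (divisor_degree D) + g)%N.
have := ell_genus (D + <[N]>); rewrite divisor_degreeD divisor_degreeP.
suff -> : ell (D + <[N]>) = 0%N by lia.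
apply: xgetPN => n Dn; apply: nD.
have [_ [b [_ Hb _]]] := has_dim_sub (subspace_rr _) (subspace_rr D) (subspace0 iota)
  (fun x => fun x0 : x = 0 => or_introl x0) (@rr_sub_addP D N) Dn.
by exists b.
Qed.

Lemma ell_eq n D : has_dim ('L D) [set 0] n -> ell D = n.
Proof. by apply: dimE; exact: subspace0. Qed.

Lemma has_dim_rr D E : ('L D `<=` 'L E)%classic ->
  exists2 a, has_dim ('L E) ('L D) a & (a + ell D)%N = ell E.
Proof.
move=> DE; have [a [b [Ha Hb ab]]] := has_dim_sub (subspace_rr E) (subspace_rr D)
  (subspace0 iota) (fun x => fun x0 : x = 0 => or_introl x0) DE (ell_fin E).
by exists a => //; rewrite (ell_eq Hb).
Qed.

Lemma ell_le D E : ('L D `<=` 'L E)%classic -> (ell D <= ell E)%N.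
Proof. by move=> /has_dim_rr[a _ <-]; exact: leq_addl. Qed.

Lemma ell_eq0 D : (forall f, 'L D f -> f = 0) -> ell D = 0%N.
Proof.
move=> D0; apply: ell_eq; exists (fun=> 0).
split=> [[]|? _ []|v /D0 ->] //.
by exists (fun=> 0); rewrite big_ord0 subr0.
Qed.

Lemma ell_gt0 D : (0 < ell D)%N -> exists2 f, f != 0 & 'L D f.
Proof.
move=> D0; apply: contrapT => nf; move: D0; rewrite ell_eq0 // => f Df.
by apply/eqP; apply: contra_notT nf => f0; exists f.
Qed.

(** Take k minimizing ell(D - kQ). By minimality the space stays the same for larger k', so a
    nonzero f in it would lie in L(D - k'Q) for a k' that its finite value at Q forbids. *)
Lemma rr_eventually0 D Q : exists k : nat, forall f, 'L (D - << k%:Z *g Q >>) f -> f = 0.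
Proof.
pose X n := `[< exists k : nat, ell (D - << k%:Z *g Q >>) = n >].
have X0 : exists n, X n by exists (ell (D - << 0%:Z *g Q >>)); apply/asboolP; exists 0%N.
case: (ex_minnP X0) => n /asboolP[k kn] minn; exists k => f Df.
have [//|f0] := eqVneq f 0.
pose k' := (k + (absz (Q f + coeff Q D)%R).+1)%N.
have [|a Ha aE] := @has_dim_rr (D - << k'%:Z *g Q >>) (D - << k%:Z *g Q >>).
  by apply: rr_sub => R; rewrite !coeffE; do ?case: eqP => _; lia.
have := minn (ell (D - << k'%:Z *g Q >>)) (asboolT (ex_intro _ k' erefl)).
rewrite -kn -aE => ale; move: Ha; have -> : a = 0%N by lia.
case=> b [_ _ /(_ _ Df) [c]]; rewrite big_ord0 subr0 => /(riemann_rochP Q)/(_ Q).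
by rewrite val_geE // !coeffE eqxx; lia.
Qed.

(* A place of infinite degree has degree 0 by convention, so that the divisors
   gP - kQ would all have degree g. *)
Lemma degree_gt0 Q : (0 < degree Q)%N.
Proof.
rewrite lt0n; apply/negP => /eqP dQ.
have [k kP] := rr_eventually0 <[g]> Q.
have := ell_genus (<[g]> - << k%:Z *g Q >>).
by rewrite divisor_degreeB divisor_degreeP divisor_degreeU dQ (ell_eq0 kP); lia.
Qed.

Lemma has_dim_degree Q : has_dim (val_space Q 0) (val_space Q 1) (degree Q).
Proof.
have := degree_gt0 Q; case E: (degree Q) => [//|d] _; exact: dim_neq0.
Qed.

(** Taking leading terms at Q embeds L(D + Q) / L(D) into a graded piece at Q, of dimension deg
    Q. *)
Lemma ell_step D Q : (ell (D + << Q >>)%R <= ell D + degree Q)%N.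
Proof.
have DQ : ('L D `<=` 'L (D + << Q >>))%classic.
  by apply: rr_sub => R; rewrite !coeffE; do ?case: eqP => _; lia.
have [a /has_dimP[b [ib _]] <-] := has_dim_rr DQ.
rewrite addnC leq_add2l.
have /has_dimP[b' [_ sb']] := has_dim_val (- coeff Q D - 1) (has_dim_degree Q).
apply: (independent_le _ sb'); first exact: subspace_val.
apply: (independent_map (a := 1)) ib => [|x|x]; first exact: subspace_rr.
  rewrite mul1r => /(riemann_rochP P)/(_ Q); apply: val_ge_le.
  by rewrite !coeffE eqxx; lia.
rewrite mul1r /val_space /= subrK => DQx xQ.
apply/(riemann_rochP P) => R; have [<-//|QR] := eqVneq Q R.
have /(riemann_rochP P)/(_ R) := DQx; apply: val_ge_le.
by rewrite !coeffE (negbTE QR); lia.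
Qed.

(** The Riemann-Roch theorem identifies this number with the index of speciality of D. *)
Definition delta D : int := (ell D)%:Z - divisor_degree D - 1 + g%:Z.

Lemma delta_ge0 D : 0 <= delta D.
Proof. by rewrite /delta; have := ell_genus D; lia. Qed.

Lemma delta_step D Q : delta (D + << Q >>) <= delta D.
Proof. by rewrite /delta divisor_degreeD divisor_degreeU; have := ell_step D Q; lia. Qed.

Lemma divisor_mulSr Q n : << n.+1%:Z *g Q >> = << n%:Z *g Q >> + << Q >> :> divisor iota.
Proof. by rewrite freegUD -addn1 PoszD. Qed.

Lemma delta_mul D Q n : delta (D + << n%:Z *g Q >>) <= delta D.
Proof.
elim: n => [|n IH]; first by rewrite freegU0 addr0.
by rewrite divisor_mulSr addrA; apply: le_trans IH; exact: delta_step.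
Qed.

Definition asymptotic D := exists n : nat, delta (D + <[n]>) = 0.

Lemma asymptoticD D Q : asymptotic D -> asymptotic (D + << Q >>).
Proof.
move=> [n Dn]; exists n; apply/eqP; rewrite eq_le delta_ge0 andbT -Dn addrAC.
exact: delta_step.
Qed.

(* Multiplying by an element a of L(NP - Q) of value w at Q turns elements of
   value exactly -(D(Q) + w) at Q into elements of value exactly -D(Q). *)
Lemma asymptoticB D Q : asymptotic D -> asymptotic (D - << Q >>).
Proof.
move=> [n Dn]; have [->|QP] := eqVneq Q P.
  by exists n.+1; rewrite divisor_mulSr addrAC addrA addrK.
set D' := D + <[n]> in Dn.
(* NP - Q then has degree g, so the genus bound gives ell >= 1. *)
pose N := (g + degree Q)%N.
have [a a0 La] : exists2 a, a != 0 & 'L (<[N]> - << Q >>) a.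
  apply: ell_gt0; have := ell_genus (<[N]> - << Q >>).
  by rewrite divisor_degreeB divisor_degreeP divisor_degreeU /N; lia.
have w1 : 1 <= Q a.
  have /(riemann_rochP P)/(_ Q) := La.
  by rewrite val_geE // !coeffE eqxx eq_sym (negbTE QP); lia.
(* The value of [a] at Q is w + 1, which is why [E] adds only wQ to [D']: the pole of order D'(Q) +
   w + 1 allowed by E + Q becomes one of order D'(Q). *)
have [w wE] : exists w : nat, Q a = w.+1%:Z by exists (absz (Q a)).-1; lia.
pose E := D' + << w%:Z *g Q >>.
have dE n' : delta (D' + << n'%:Z *g Q >>) = 0.
  by apply/eqP; rewrite eq_le delta_ge0 andbT -Dn; exact: delta_mul.
have EQ : E + << Q >> = D' + << w.+1%:Z *g Q >> by rewrite divisor_mulSr addrA.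
have [|d /has_dimP[b [ib _]] dl] := @has_dim_rr E (E + << Q >>).
  by apply: rr_sub => R; rewrite !coeffE; do ?case: eqP => _; lia.
(* Both delta E and delta (E + Q) vanish, so this step attains the bound of [ell_step]. *)
have dd : d = degree Q.
  have := dE w; have := dE w.+1; rewrite -EQ -/E /delta divisor_degreeD divisor_degreeU; lia.
pose G := D' + <[N]>.
have [|d' /has_dimP[b' [_ sb']] dl'] := @has_dim_rr (G - << Q >>) G.
  by apply: rr_sub => R; rewrite !coeffE; do ?case: eqP => _; lia.
(* Multiplication by [a] embeds L(E + Q) / L(E) into L(G) / L(G - Q); hence removing Q from G lowers
   ell by at least deg Q and does not increase delta. *)
have : (d <= d')%N.
  apply: (independent_le _ sb'); first exact: subspace_rr.
  apply: (independent_map (a := a)) ib => [|x Ex|x Ex Gx]; first exact: subspace_rr.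
    apply/(riemann_rochP P) => R; have /(riemann_rochP P)/(_ R) xR := Ex.
    have [QR|QR] := eqVneq Q R.
      rewrite -QR in xR *.
      have aQ : val_ge Q (Q a) a by rewrite val_geE.
      apply: val_ge_le (val_geM aQ xR).
      by rewrite wE !coeffE eqxx eq_sym (negbTE QP); lia.
    have /(riemann_rochP P)/(_ R) aR := La.
    apply: val_ge_le (val_geM aR xR).
    by rewrite !coeffE (negbTE QR); do ?case: eqP => _; lia.
  apply/(riemann_rochP P) => R; have /(riemann_rochP P)/(_ R) xR := Ex.
  have [QR|QR] := eqVneq Q R; last first.
    by apply: val_ge_le xR; rewrite !coeffE (negbTE QR); lia.
  rewrite -QR.
  have /(riemann_rochP P)/(_ Q) axQ := Gx.
  have aQ : val_ge Q (- Q a) a^-1 by rewrite val_geE ?invr_neq0 // dvalV.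
  have := val_geM aQ axQ; rewrite mulKf //; apply: val_ge_le.
  by rewrite wE !coeffE eqxx eq_sym (negbTE QP); lia.
move=> dd'; exists (n + N)%N.
have -> : D - << Q >> + <[n + N]> = G - << Q >>.
  by rewrite PoszD -freegUD /G /D' -!addrA; congr (_ + _); rewrite addrC -addrA.
have Gd : delta G <= 0 by rewrite -Dn; exact: delta_mul.
apply/eqP; rewrite eq_le delta_ge0 andbT; move: Gd.
rewrite /delta divisor_degreeB divisor_degreeU; lia.
Qed.

Lemma asymptotic_mul D Q (k : int) : asymptotic D -> asymptotic (D + << k *g Q >>).
Proof.
move=> AD; case: (intP k) => [|n|n]; first by rewrite freegU0 addr0.
  elim: n.+1 => {n} [|n IH]; first by rewrite freegU0 addr0.
  by rewrite divisor_mulSr addrA; exact: asymptoticD.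
rewrite -freegUN; elim: n.+1 => {n} [|n IH]; first by rewrite freegU0 subr0.
by rewrite divisor_mulSr opprD addrA; exact: asymptoticB.
Qed.

Lemma asymptotic_sum (r : seq (place iota)) (c : place iota -> int) D :
  asymptotic D -> asymptotic (D + \sum_(Q <- r) << c Q *g Q >>).
Proof.
elim: r D => [|Q r IH] D AD; first by rewrite big_nil addr0.
by rewrite big_cons addrA; apply: IH; exact: asymptotic_mul.
Qed.

(** A divisor attaining the genus has delta equal to 0, and D differs from it by a finite sum of
    multiples of places. *)
Lemma asymptotic_all D : asymptotic D.
Proof.
have [[D0 HD0] _] := F_genus.
have -> : D = D0 + (D - D0) by rewrite addrC subrK.
rewrite -[D - D0]freeg_sumE; apply: asymptotic_sum.
by exists 0%N; rewrite freegU0 addr0 /delta; lia.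
Qed.

End Genus.

(** * Vanishing of delta in degree at least 2g - 1 *)

Section Speciality.
Variables (K F : fieldType) (iota : {rmorphism K -> F}) (g : nat) (P : place iota).
Hypotheses (F_genus : has_genus iota g) (degP : degree P = 1%N).
Implicit Types (Q R : place iota) (D E : divisor iota).
Local Notation "''L' D" := (riemann_roch D) (at level 8, D at level 8).
Local Notation has_dim := (has_dim iota).
Local Notation subspace := (subspace iota).
Local Notation "<[ n ]>" := (<< n%:Z *g P >> : divisor iota).
Local Notation delta := (delta g).

Let ell_genus := ell_genus F_genus degP.
Let ell_fin := ell_fin F_genus degP.
Let has_dim_rr := has_dim_rr F_genus degP.
Let delta_ge0 := delta_ge0 F_genus degP.

Lemma rr_eq D E : ('L D `<=` 'L E)%classic -> ell D = ell E -> ('L E `<=` 'L D)%classic.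
Proof.
move=> /has_dim_rr[a Ha aE] DE f Ef; move: Ha; have -> : a = 0%N by lia.
by case=> b [_ _ /(_ f Ef) [c]]; rewrite big_ord0 subr0.
Qed.

(** The power f^k lies in L(-kP), which is 0 for a suitable k; this replaces an appeal to the
    product formula. *)
Lemma rr_Pneg f : 'L (- << P >>) f -> f = 0.
Proof.
have [k kP] := rr_eventually0 F_genus degP 0 P.
have [-> //|f0] := eqVneq f 0 => Pf.
suff /kP/eqP : 'L (0 - << k%:Z *g P >>) (f ^+ k).
  by rewrite expf_eq0 => /andP[_ /eqP].
apply/(riemann_rochP P) => Q; have /(riemann_rochP P)/(_ Q) := Pf.
rewrite !val_geE ?expf_neq0 // dvalX // !coeffE coeff0.
by case: eqP => _; nia.
Qed.

(** With O the elements allowed by D at P, (O + L(D + nP)) / O is L(D + nP) / L(D). What remains of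
    the n dimensions is k = delta D - delta (D + nP), a finite piece of the first cohomology of
    D. *)
Lemma complement_span D n : exists k (b : 'I_k -> F),
  [/\ (k + ell (D + <[n]>)%R = n + ell D)%N,
      forall i, val_ge P (- coeff P D - n%:Z) (b i)
    & spanning iota (val_space P (- coeff P D - n%:Z))
        (setsum (val_space P (- coeff P D)) ('L (D + <[n]>))) b].
Proof.
set V := val_space P (_ - _); set O := val_space P (- _).
have sO : subspace O by exact: subspace_val.
have sV : subspace V by exact: subspace_val.
have VO : has_dim V O n by apply: has_dim_val_tower; exact: has_dim_P.
have [a Ha aE] := has_dim_rr (@rr_sub_addP _ _ _ P degP D n).
have LO : ('L (D + <[n]>) `&` O)%classic = 'L D.
  apply/seteqP; split=> f.
    move=> [/(riemann_rochP P) Df Of]; apply/(riemann_rochP P) => Q.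
    have [<-//|PQ] := eqVneq P Q.
    by have := Df Q; apply: val_ge_le; rewrite !coeffE (negbTE PQ); lia.
  move=> Df; split; first exact: rr_sub_addP degP D n f Df.
  by have /(riemann_rochP P)/(_ P) := Df.
have [||k [d [[b [Vb fb sb]] Hd kd]]] :=
  has_dim_sub sV (subspace_setsum sO (subspace_rr (D + <[n]>))) sO _ _ VO.
- by move=> x Ox; apply: setsuml => //; exact: subspace_rr.
- move=> _ [x [f [Ox Df ->]]]; apply: (subspaceD sV).
    by apply: val_ge_le Ox; lia.
  have /(riemann_rochP P)/(_ P) := Df.
  by rewrite !coeffE eqxx opprD.
have da : d = a.
  apply: has_dim_uniq Hd _ => //; apply: has_dim_setsum => //; first exact: subspace_rr.
  by rewrite LO.
by exists k, b; split=> //; lia.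
Qed.

(* Below, V holds the elements allowed by D away from P and O those allowed by D
   at P, so that F / (V + O) is the first cohomology of D, of dimension delta D.
   If it is 1, then for N large L(NP) has larger dimension than the first
   cohomology of D - NP, so some nonzero h in L(NP) maps the latter to 0; but
   multiplication by h is onto F, which is not V + O. *)
Lemma delta_neq1 D : 2 * g%:Z - 1 <= divisor_degree D ->
  delta (D + << P >>) = 0 -> delta D != 1.
Proof.
move=> degD DP; apply/eqP => D1.
have eDP : ell D = ell (D + << P >>).
  by move: DP D1; rewrite /delta divisor_degreeD divisor_degreeU degP; lia.
have [N N0] := rr_eventually0 F_genus degP D P.
set c : int := coeff P D.
pose O := val_space P (- c).
pose V : set F := fun f => forall Q, Q != P -> val_ge Q (- coeff Q D) f.
have sO : subspace O by exact: subspace_val.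
have sV : subspace V.
  split=> [Q _|a x y Vx Vy Q QP]; first exact: val_ge0.
  by have [_ H] := subspace_val Q (- coeff Q D); apply: H; [exact: Vx|exact: Vy].
have sW := subspace_setsum sO sV.
have [u u0 uP] := dval_onto P (- c - 1).
(* If u = o + a, then a lies in L(D + P), which equals L(D) by [eDP]; so u would have value at least
   -c at P. *)
have nWu : ~ setsum O V u.
  case=> o [a [Oo Va uE]].
  have La : 'L (D + << P >>) a.
    apply/(riemann_rochP P) => Q; have [QP|QP] := eqVneq Q P.
      rewrite QP !coeffE eqxx -/c; have -> : a = u - o by rewrite uE addrAC subrr add0r.
      by apply: val_geB; [rewrite val_geE // uP; lia|apply: val_ge_le Oo; lia].
    by apply: val_ge_le (Va Q QP); rewrite !coeffE eq_sym (negbTE QP); lia.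
  have /(riemann_rochP P)/(_ P) aP : 'L D a.
    by apply: rr_eq La => //; apply: rr_sub => R; rewrite !coeffE; case: eqP => _; lia.
  by have := val_geD Oo aP; rewrite -uE val_geE // uP; lia.
have [k1 [b1 [k1E _ sb1]]] := complement_span D N.+1.
(* k1 is delta D - delta (D + (N+1)P) = 1 - 0. *)
have {k1E} k11 : k1 = 1%N.
  have := delta_mul F_genus degP (D + << P >>) P N; rewrite DP -addrA [<< P >> + _]addrC -divisor_mulSr.
  have := delta_ge0 (D + <[N.+1]>); move: D1.
  rewrite /delta divisor_degreeD (divisor_degreeP degP).
  move: k1E; move: (ell D) (ell (D + _)) (divisor_degree D) => x y w; lia.
subst k1.
have [k2 [b2 [k2E b2P sb2]]] := complement_span (D - <[N]>) N.+1.
have DE : D - <[N]> + <[N.+1]> = D + << P >> by rewrite divisor_mulSr -addrA addKr.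
rewrite DE (ell_eq0 N0) addn0 in k2E.
(* Here deg D >= 2g - 1 enters: k2 = N + 1 - ell(D + P) <= N - g, whereas ell(NP) >= N + 1 - g. *)
have lt2 : (k2 < ell <[N]>)%N.
  have := ell_genus (D + << P >>); have := ell_genus <[N]>.
  by rewrite divisor_degreeD !(divisor_degreeP degP); lia.
have [f [Lf ff _]] := ell_fin <[N]>.
have cN : coeff P (D - <[N]>) = c - N%:Z by rewrite !coeffE eqxx.
rewrite cN in b2P sb2.
have fP i Q : val_ge Q (- coeff Q <[N]>) (f i) by have /(riemann_rochP P) := Lf i.
(* The product of [f i] and [b2 j] has value at least -c - (N+1) at P, so modulo O + V it is a
   multiple of the single generator [b1 ord0]. *)
have /choice[A AP] : forall i, exists A : 'I_k2 -> K, forall j,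
    setsum O V (f i * b2 j - iota (A j) * b1 ord0).
  move=> i; suff /choice[A HA] : forall j, exists a : K,
    setsum O V (f i * b2 j - iota a * b1 ord0) by exists A.
  move=> j.
  have [|d] := sb1 (f i * b2 j).
    have := val_geM (fP i P) (b2P j); apply: val_ge_le.
    by rewrite coeff_single eqxx; lia.
  rewrite big_ord1 => -[x [l [Ox Ll E]]]; exists (d ord0), x, l; split=> // Q QP.
  have /(riemann_rochP P)/(_ Q) := Ll; apply: val_ge_le.
  by rewrite !coeffE eq_sym (negbTE QP); lia.
have [e [i0 e0] eA] := underdetermined A lt2.
pose h := \sum_i iota (e i) * f i.
have Lh : 'L <[N]> h by apply: subspace_comb => //; exact: subspace_rr.
have h0 : h != 0 by apply: contra_neq e0 => h0; exact: ff.
(* Otherwise h would lie in L(-P), which is 0. Hence u / h has value at least -c - 1 at P, the range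
   that [sb2] covers. *)
have hP : P h <= 0.
  rewrite leNgt; apply: (contraNN _ h0) => hP; apply/eqP/rr_Pneg/(riemann_rochP P) => Q.
  rewrite !coeffE; case: eqP => [<-|PQ]; first by rewrite val_geE //; lia.
  have /(riemann_rochP P)/(_ Q) := Lh; apply: val_ge_le.
  by rewrite coeff_single; case: eqP.
have hb j : setsum O V (h * b2 j).
  suff -> : h * b2 j = \sum_i iota (e i) * (f i * b2 j - iota (A i j) * b1 ord0).
    by apply: (subspace_sum sW) => i; apply: (subspaceZ _ sW).
  under [RHS]eq_bigr do rewrite mulrBr mulrA [X in _ - X]mulrA -rmorphM.
  by rewrite sumrB -!mulr_suml -rmorph_sum eA rmorph0 mul0r subr0.
have [|d [x [l [Ox Ll E]]]] := sb2 (u / h).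
  by rewrite /val_space /= val_geE ?mulf_neq0 ?invr_neq0 // dvalM ?invr_neq0 // dvalV // uP; lia.
apply: nWu.
(* Multiplying the decomposition of u / h by h puts all three terms in O + V, against [nWu]. *)
have -> : u = h * x + h * l + \sum_j iota (d j) * (h * b2 j).
  rewrite -mulrDr -E mulrBr mulrCA divff // mulr1 mulr_sumr.
  by under [X in _ - X]eq_bigr do rewrite mulrCA; rewrite subrK.
apply: (subspaceD sW); last by apply: (subspace_comb _ sW).
exists (h * x), (h * l); split=> //.
  have /(riemann_rochP P)/(_ P) hN := Lh; have := val_geM hN Ox.
  by apply: val_ge_le; rewrite coeff_single eqxx; lia.
move=> Q QP; have /(riemann_rochP P)/(_ Q) hQ := Lh.
have /(riemann_rochP P)/(_ Q) lQ := Ll; have := val_geM hQ lQ; apply: val_ge_le.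
by rewrite !coeffE eq_sym (negbTE QP); lia.
Qed.

(** Descent along D + nP from an n where delta vanishes: removing one P raises delta by at most 1,
    and the value 1 is excluded by [delta_neq1]. *)
Theorem nonspecial D : 2 * g%:Z - 1 <= divisor_degree D -> delta D = 0.
Proof.
move=> degD; have [n Dn] := asymptotic_all F_genus degP D.
elim: n D degD Dn => [|n IH] D degD Dn; first by rewrite freegU0 addr0 in Dn.
have D1 : delta (D + << P >>) = 0.
  apply: IH; first by rewrite divisor_degreeD divisor_degreeU degP; lia.
  by rewrite -addrA [<< P >> + _]addrC -divisor_mulSr.
have := delta_neq1 degD D1; have := delta_ge0 D.
have : (ell D <= ell (D + << P >>)%R)%N.
  by apply: (ell_le F_genus degP); apply: rr_sub => R; rewrite !coeffE; case: eqP => _; lia.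
move: D1; rewrite /delta divisor_degreeD divisor_degreeU degP; lia.
Qed.

End Speciality.

(** * Linearity of local expansions, and their link with values *)

Section LocalExpansions.
Variables (K F : fieldType) (iota : {rmorphism K -> F}) (P : place iota).
Variables (Fh : completion P) (E : fieldExtType K) (tau : coefficient_field Fh E).
Variable z : F.

Lemma val_ge_emb n x : val_ge (comp_val Fh) n (comp_emb Fh x) = val_ge P n x.
Proof. by rewrite /val_ge fmorph_eq0 comp_valE. Qed.

Lemma local_expansion0 : local_expansion tau z 0 (fun=> 0).
Proof.
move=> N; exists 0%N => n _; rewrite big1 => [|i _]; last by rewrite rmorph0 mul0r.
by rewrite rmorph0 subr0 val_ge0.
Qed.

Lemma local_expansionP c x y (beta gamma : nat -> E) :
  local_expansion tau z x beta -> local_expansion tau z y gamma ->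
  local_expansion tau z (iota c * x + y) (fun k => c *: beta k + gamma k).
Proof.
move=> xb yg N; have [n1 n1P] := xb N; have [n2 n2P] := yg N.
exists (maxn n1 n2) => n; rewrite geq_max => /andP[n1n n2n].
have -> : \sum_(k < n) tau (c *: beta k + gamma k) * comp_emb Fh z ^+ k
    - comp_emb Fh (iota c * x + y) =
  comp_emb Fh (iota c) *
    (\sum_(k < n) tau (beta k) * comp_emb Fh z ^+ k - comp_emb Fh x)
  + (\sum_(k < n) tau (gamma k) * comp_emb Fh z ^+ k - comp_emb Fh y).
  rewrite mulrBr addrACA -opprD -rmorphM -rmorphD; congr (_ - _).
  rewrite mulr_sumr -big_split; apply: eq_bigr => k _ /=.
  by rewrite rmorphD /= -mulr_algl rmorphM cf_const mulrDl mulrA.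
apply: val_geD; last exact: n2P.
rewrite -[N%:Z]add0r; apply: val_geM; last exact: n1P.
by rewrite val_ge_emb val_ge_iota.
Qed.

Lemma local_expansion_comb m (c : 'I_m -> K) (y : nat -> F) (beta : nat -> nat -> E) :
  (forall r, local_expansion tau z (y r) (beta^~ r)) ->
  local_expansion tau z (\sum_(r < m) iota (c r) * y r)
    (fun k => \sum_(r < m) c r *: beta k r).
Proof.
move=> yb; elim: m c => [|m IH] c.
  have := local_expansion0; congr local_expansion; first by rewrite big_ord0.
  by apply/funext => k; rewrite big_ord0.
have := local_expansionP (c ord_max) (yb m) (IH (fun i => c (widen_ord (leqnSn m) i))).
congr local_expansion; first by rewrite big_ord_recr addrC.
by apply/funext => k; rewrite big_ord_recr addrC.
Qed.

(** Terms from z^n on have value at least n, and some partial sum approximates y to precision n. *)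
Lemma local_expansion_val y (beta : nat -> E) n : P z = 1 ->
  local_expansion tau z y beta -> (forall k, (k < n)%N -> beta k = 0) ->
  val_ge P n%:Z y.
Proof.
move=> z1 /(_ n)[N NP] b0; rewrite -val_ge_emb.
have -> : comp_emb Fh y = \sum_(k < N) tau (beta k) * comp_emb Fh z ^+ k -
    (\sum_(k < N) tau (beta k) * comp_emb Fh z ^+ k - comp_emb Fh y).
  by rewrite opprB addrC subrK.
apply: val_geB (NP N (leqnn N)); apply: val_ge_sum => k.
have [kn|nk] := ltnP k n; first by rewrite b0 // rmorph0 mul0r val_ge0.
rewrite -[n%:Z]add0r; apply: val_geM; first exact: cf_int.
have z0 : z != 0 by apply/eqP => z0; move: z1; rewrite z0 dval0.
by rewrite -rmorphXn val_ge_emb val_geE ?expf_neq0 // dvalX // z1; lia.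
Qed.

End LocalExpansions.

(** * Linear independence of the rows of the generating matrices *)

Section Rows.
Variables (K F : fieldType) (iota : {rmorphism K -> F}) (g : nat) (P : place iota).
Hypotheses (F_genus : has_genus iota g) (degP : degree P = 1%N).
Variables (nn : nat -> nat) (y : nat -> F).
Hypothesis nn_enum : nongap_enumeration P nn.
Hypothesis y_in : forall r, riemann_roch << (nn r)%:Z *g P >> (y r).
Hypothesis y_notin : forall r, ~ riemann_roch << ((nn r)%:Z - 1) *g P >> (y r).
Local Notation "''L' D" := (riemann_roch D) (at level 8, D at level 8).
Local Notation "<[ n ]>" := (<< n%:Z *g P >> : divisor iota).

Lemma nongap_lt r r' : (r < r')%N -> (nn r < nn r')%N.
Proof. by case: nn_enum => + _; apply. Qed.

Lemma nongap_nn r : ~ gap_number P (nn r).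
Proof.
case: nn_enum => _ E; have : range nn (nn r) by exists r.
by rewrite E.
Qed.

Lemma nongap_surj n : ~ gap_number P n -> exists r, nn r = n.
Proof.
case: nn_enum => _ E ng; have : range nn n by rewrite E.
by case=> r _ <-; exists r.
Qed.

(** From nP to (n+1)P the dimension grows by at most deg P = 1, and it grows exactly when n + 1 is
    not a gap. *)
Lemma ell_count n : exists2 r, ell <[n]> = r & forall r', (nn r' <= n)%N = (r' < r)%N.
Proof.
elim: n => [|n [r En rP]].
  (* L(0) contains 1, and it is one step above L(-P) = 0. *)
  have L0 : ell <[0]> = 1%N.
    apply/eqP; rewrite eqn_leq; apply/andP; split; last first.
      rewrite lt0n; apply/eqP => E0.
      have [b [_ _ /(_ 1) []]] := ell_fin F_genus degP <[0]>.
        by right=> Q; rewrite dval1 freegU0 coeff0.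
      rewrite E0 in b * => c; rewrite big_ord0 subr0 => /eqP.
      by rewrite oner_eq0.
    have := ell_step F_genus degP (- << P >>) P; rewrite degP addrC subrr.
    by rewrite freegU0 (ell_eq0 (rr_Pneg F_genus degP)).
  exists 1%N => // r'.
  have [r0 r00] : exists r, nn r = 0%N by apply: nongap_surj; case.
  have r00' : r0 = 0%N by case: r0 r00 => // r0 H; have := @nongap_lt 0 r0.+1 isT; rewrite H.
  subst r0; case: r' => [|r']; first by rewrite r00.
  by have := @nongap_lt 0 r'.+1 isT; rewrite r00; lia.
have lemono a b : (nn a <= nn b)%N = (a <= b)%N.
  case: (ltngtP a b) => [/nongap_lt/ltnW//|/nongap_lt|->]; last by rewrite leqnn.
  by rewrite ltnNge => /negbTE.
have np1 : <[n.+1]> = <[n]> + << P >> by rewrite divisor_mulSr.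
have st := ell_step F_genus degP <[n]> P; rewrite degP -np1 in st.
have le := ell_le F_genus degP (rr_sub_addP degP (D := <[n]>) 1); rewrite -np1 in le.
have gE : ell << n.+1%:Z - 1 *g P >> = ell <[n]> by congr (ell << _ *g P >>); lia.
have [[_ E]|ng] := pselect (gap_number P n.+1).
  exists r => [|r']; first by rewrite E gE.
  rewrite leq_eqVlt ltnS rP; case: eqP => //= H.
  have := @nongap_nn r'; rewrite H; case; split=> //.
exists r.+1.
  have /eqP : ell <[n.+1]> <> ell <[n]> by move=> E; apply: ng; split => //; rewrite gE.
  by lia.
have [r1 r1E] := nongap_surj ng; move=> r'.
have -> : r = r1.
  apply/eqP; rewrite eqn_leq leqNgt -rP r1E ltnn /= leqNgt; apply/negP => rr1.
  by have := nongap_lt rr1; rewrite r1E ltnS rP ltnn.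
by rewrite -r1E lemono ltnS.
Qed.

(** The pole orders of the [y r] at P are distinct: a nonzero last coefficient would put the last
    [y] into the span of functions with smaller poles. *)
Lemma y_free m (c : 'I_m -> K) : \sum_(r < m) iota (c r) * y r = 0 -> forall r, c r = 0.
Proof.
elim: m c => [|m IH] c; first by move=> _ [].
rewrite big_ord_recr /= => E.
have cm : c ord_max = 0.
  apply: contrapT => /eqP cm; apply: (@y_notin m).
  have -> : y m = \sum_(r < m) iota (- (c ord_max)^-1 * c (widen_ord (leqnSn m) r)) * y r.
    under eq_bigr do rewrite rmorphM -mulrA.
    rewrite -mulr_sumr; move/eqP: E; rewrite addr_eq0 => /eqP ->.
    by rewrite rmorphN mulrNN mulrA -rmorphM mulVf // rmorph1 mul1r.
  apply: subspace_comb => [|r]; first exact: subspace_rr.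
  have rm := nongap_lt (ltn_ord r).
  have := @y_in r; apply: rr_sub => Q; rewrite !coeff_single.
  by case: eqP => _; lia.
move: E; rewrite cm rmorph0 mul0r addr0 => /IH c0 r.
case: (unliftP ord_max r) => [j ->|-> //]; have := c0 j; congr (c _ = 0).
by apply/val_inj; rewrite /= /bump leqNgt ltn_ord.
Qed.

Variables (s : nat) (Ps : 'I_s -> place iota).
Hypotheses (Ps_inj : injective Ps) (Ps_neq : forall i, Ps i != P).
Variables (z : 'I_s -> F) (Fh : forall i, completion (Ps i)) (E : 'I_s -> fieldExtType K).
Hypothesis z_param : forall i, Ps i (z i) = 1.
Variables (tau : forall i, coefficient_field (Fh i) (E i)) (beta : forall i, nat -> nat -> E i).
Hypothesis beta_exp : forall i r,
  local_expansion (tau i) (z i) (y r) (fun k => beta i k r).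
Variable bas : forall i, (degree (Ps i)).-tuple (E i).
Hypothesis bas_basis : forall i, basis_of fullv (bas i).
Variable C : 'I_s -> nat -> nat -> K.
Hypothesis C_def : forall i k (h : 'I_(degree (Ps i))) r,
  C i (k * degree (Ps i) + h)%N r = coord (bas i) h (beta i k r).

(** The first k blocks of rows hold the coordinates of the first k expansion coefficients of the
    combination. *)
Lemma rows_kernel m k i (c : 'I_m -> K) :
  (forall j, (j < k * degree (Ps i))%N -> \sum_(r < m) c r * C i j r = 0) ->
  val_ge (Ps i) k%:Z (\sum_(r < m) iota (c r) * y r).
Proof.
move=> Cc; have := local_expansion_comb c (beta_exp i).
move=> /local_expansion_val; apply => // l lk.
rewrite (coord_basis (bas_basis i) (memvf (\sum_(r < m) c r *: beta i l r))).
apply: big1 => h _; rewrite linear_sum.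
under eq_bigr do rewrite linearZ /= -C_def.
rewrite Cc ?scale0r //; apply: leq_trans (_ : (l.+1 * degree (Ps i) <= _)%N).
  by rewrite mulSn addnC ltn_add2r.
by rewrite leq_mul2r lk orbT.
Qed.

Lemma rows_full (k : 'I_s -> nat) m : (0 < m)%N ->
  (g + \sum_i k i * degree (Ps i) <= m)%N ->
  forall w : 'I_s -> nat -> K, exists c : 'I_m -> K,
    forall i j, (j < k i * degree (Ps i))%N -> \sum_(r < m) c r * C i j r = w i j.
Proof.
(* This n makes ell(nP) = m; the degree is at least 2g - 1 because g <= m. *)
move=> m0 le_m w; pose n := (m.-1 + g)%N.
pose J := {i : 'I_s & 'I_(k i * degree (Ps i))}.
(* Transposed layout: the columns of [A] are the selected rows of the [C i], cut to length m. *)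
pose A := \matrix_(r < m, x < #|{: J}|) C (tag (enum_val x)) (tagged (enum_val x)) r.
have cardJ : #|{: J}| = (\sum_i k i * degree (Ps i))%N.
  by rewrite card_tagged sumnE big_map big_enum; apply: eq_bigr => i _; rewrite card_ord.
pose D := <[n]> - \sum_(i < s) << (k i)%:Z *g Ps i >>.
have degD : divisor_degree D = n%:Z - #|{: J}|%:Z.
  rewrite divisor_degreeB (divisor_degreeP degP) cardJ; congr (_ - _).
  rewrite (big_morph _ (@divisor_degreeD _ _ iota) (_ : _ = 0)); last first.
    by rewrite /divisor_degree dom0 big_nil.
  rewrite (big_morph Posz PoszD (erefl _)); apply: eq_bigr => i _.
  by rewrite divisor_degreeU PoszM.
(* deg D = m - 1 + g - #|J| is at least 2g - 1 exactly by the bound on m. *)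
have ellD : (ell D + #|{: J}| = m)%N.
  have := nonspecial F_genus degP (D := D); rewrite /delta degD cardJ /n => /(_ _)/wrap[].
    by lia.
  by lia.
have elln : ell <[n]> = m.
  have := nonspecial F_genus degP (D := <[n]>).
  by rewrite /delta (divisor_degreeP degP) /n => /(_ _)/wrap[]; lia.
have coeffsum Q : coeff Q (\sum_(i < s) << (k i)%:Z *g Ps i >> : divisor iota) =
    \sum_(i < s) if Ps i == Q then (k i)%:Z else 0.
  rewrite (big_morph _ (@coeff_add _ _ iota Q) (coeff0 _ _)).
  by apply: eq_bigr => i _; exact: coeff_single.
have yLn (c : 'I_m -> K) : 'L <[n]> (\sum_(r < m) iota (c r) * y r).
  apply: subspace_comb => [|r]; first exact: subspace_rr.
  have := @y_in r; apply: rr_sub => Q; rewrite !coeff_single; case: eqP => // _.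
  have [r0 r0E r0P] := ell_count n; have := r0P r.
  by rewrite -r0E elln ltn_ord lez_nat.
have kerD (c : 'rV[K]_m) : c *m A = 0 -> 'L D (\sum_(r < m) iota (c 0 r) * y r).
  move=> cA0; apply/(riemann_rochP P) => Q; rewrite coeff_add coeff_opp coeffsum.
  have [[i iQ]|nQ] := pselect (exists i, Ps i = Q).
    rewrite -iQ (bigD1 i) //= eqxx big1 ?addr0; last first.
      by move=> j ji; case: eqP => // /Ps_inj ij; rewrite ij eqxx in ji.
    rewrite coeff_single eq_sym (negbTE (Ps_neq i)) sub0r opprK.
    apply: rows_kernel => j jk.
    have /rowP/(_ (enum_rank (Tagged _ (Ordinal jk) : J))) := cA0.
    rewrite !mxE => E0; rewrite -[RHS]E0.
    by apply: eq_bigr => r _; rewrite mxE enum_rankK.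
  rewrite big1 => [|i _]; last by case: eqP => // iQ; case: nQ; exists i.
  rewrite subr0; have /(riemann_rochP P) := yLn (fun r => c 0 r); exact.
(* By [kerD] and [y_free], a basis of the left kernel yields independent elements of L(D). As ell D
   = m - #|J|, the rank of [A] is then #|J|. *)
have rk : (\rank (kermx A) <= ell D)%N.
  pose B := row_base (kermx A).
  have [b [_ _ sb]] := ell_fin F_genus degP D.
  apply: (independent_le (b := b) (c := fun i => \sum_(r < m) iota (B i r) * y r)
    (subspace0 iota) sb).
  split=> [i|c E0].
    have <- : \sum_(r < m) iota (row i B 0 r) * y r = \sum_(r < m) iota (B i r) * y r.
      by apply: eq_bigr => r _; rewrite mxE.
    apply: kerD.
    by apply/sub_kermxP; apply: submx_trans (row_sub i B) _; rewrite eq_row_base.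
  have cB0 : (\row_i c i) *m B = 0.
    apply/rowP => r; rewrite mxE [RHS]mxE.
    have : \sum_(r < m) iota (\sum_i c i * B i r) * y r = 0.
      rewrite -[RHS]E0.
      under [RHS]eq_bigr do rewrite mulr_sumr.
      rewrite [RHS]exchange_big /=; apply: eq_bigr => r' _.
      rewrite rmorph_sum mulr_suml; apply: eq_bigr => i _.
      by rewrite rmorphM mulrA.
    move=> /y_free/(_ r) E1; rewrite -[RHS]E1.
    by apply: eq_bigr => i _; rewrite mxE.
  have /row_free_inj Binj : row_free B by exact: row_base_free.
  move: cB0; rewrite -(mul0mx _ B) => /Binj/rowP c0 i.
  by have := c0 i; rewrite !mxE.
have fullA : row_full A.
  rewrite /row_full eqn_leq rank_leq_col /=.
  by move: rk; rewrite mxrank_ker; have := rank_leq_row A; lia.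
have [B BA] := row_fullP fullA.
pose W := \row_(x < #|{: J}|) w (tag (enum_val x)) (tagged (enum_val x)).
exists (fun r => (W *m B) 0 r) => i j jk.
have := mulmxA W B A; rewrite BA mulmx1 => /rowP/(_ (enum_rank (Tagged _ (Ordinal jk) : J))).
rewrite !mxE enum_rankK /= => ->; apply: eq_bigr => r _.
by rewrite [A _ _]mxE enum_rankK.
Qed.

(** Rounding [d i] up to whole blocks of e_i rows costs at most e_i - 1 rows, the source of these
    terms in t. *)
Theorem rows_surjective (d : 'I_s -> nat) m : (0 < m)%N ->
  (g + \sum_i (degree (Ps i) - 1) + \sum_i d i <= m)%N ->
  forall w : 'I_s -> nat -> K, exists c : 'I_m -> K,
    forall i j, (j < d i)%N -> \sum_(r < m) c r * C i j r = w i j.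
Proof.
move=> m0 le_m w; have e0 i : (0 < degree (Ps i))%N by exact: (degree_gt0 F_genus degP).
pose k i := ((d i + (degree (Ps i) - 1)) %/ degree (Ps i))%N.
have [|c cP] := rows_full (k := k) m0 _ w.
  apply: leq_trans le_m; rewrite -addnA leq_add2l -big_split /=.
  by apply: leq_sum => i _; rewrite [X in (_ <= X)%N]addnC; exact: leq_trunc_div.
exists c => i j jd; apply: cP; apply: leq_trans jd _.
have := divn_eq (d i + (degree (Ps i) - 1))%N (degree (Ps i)).
have := ltn_pmod (d i + (degree (Ps i) - 1))%N (e0 i).
rewrite -/(k i); have := e0 i; lia.
Qed.

End Rows.

(** * Base-b digits, truncations and elementary intervals *)

Section Digits.
Variable (b : nat).
Hypothesis b_gt1 : (1 < b)%N.
Implicit Types (d : nat -> 'I_b) (m n k r : nat).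

Let b_gt0 : (0 < b)%N. Proof. exact: ltnW. Qed.

(** Most significant digit first: the numerator of the m-digit truncation over b^m. *)
Fixpoint digits_value d m : nat :=
  if m is m'.+1 then (digits_value d m' * b + d m')%N else 0%N.

Lemma digits_value_lt d m : (digits_value d m < b ^ m)%N.
Proof.
elim: m => [|m IH] //=; rewrite expnSr; have := ltn_ord (d m).
have : ((digits_value d m).+1 * b <= b ^ m * b)%N by rewrite leq_mul2r IH orbT.
by lia.
Qed.

Lemma digits_value_div d m n : (digits_value d (m + n) %/ b ^ n)%N = digits_value d m.
Proof.
elim: n => [|n IH]; first by rewrite addn0 divn1.
by rewrite addnS /= expnS divnMA divnMDl // (divn_small (ltn_ord _)) addn0.
Qed.

Lemma digits_of_value m a : (a < b ^ m)%N -> exists w : nat -> 'I_b,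
  forall d, digits_value d m = a <-> forall j, (j < m)%N -> d j = w j.
Proof.
elim: m a => [|m IH] a am.
  by exists (fun=> Ordinal b_gt0) => d; split=> // _; move: am; rewrite expn0 ltnS leqn0 => /eqP.
have [|w wP] := IH (a %/ b)%N; first by rewrite ltn_divLR // -expnSr.
have ab : (a %% b < b)%N by rewrite ltn_mod.
exists (fun j => if j == m then Ordinal ab else w j) => d; split=> [E j|E].
  rewrite ltnS leq_eqVlt; case: eqP => [-> _|_ /= jm].
    by apply/val_inj; rewrite /= -E /= modnMDl modn_small.
  by apply: (wP d).1 jm; rewrite -E /= divnMDl // (divn_small (ltn_ord _)) addn0.
rewrite /= [RHS](divn_eq a b); congr (_ * _ + _)%N.
  by apply/(wP d).2 => j jm; rewrite E ?(ltn_eqF jm) // ltnS ltnW.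
by rewrite E ?eqxx.
Qed.

(** In the block of indices k b^m + n with n < b^m, digits below position m come from n and the
    others from k. *)
Lemma digit_low m k n r : (r < m)%N ->
  ((k * b ^ m + n) %/ b ^ r %% b = n %/ b ^ r %% b)%N.
Proof.
move=> rm; have -> : (k * b ^ m = k * b ^ (m - r.+1) * b * b ^ r)%N.
  by rewrite -!mulnA -expnS -expnD; congr (_ * b ^ _)%N; lia.
by rewrite divnMDl ?expn_gt0 ?b_gt0 // modnMDl.
Qed.

Lemma digit_high m k n r : (n < b ^ m)%N ->
  ((k * b ^ m + n) %/ b ^ (m + r) = k %/ b ^ r)%N.
Proof.
by move=> nm; rewrite expnD divnMA divnMDl ?expn_gt0 ?b_gt0 // (divn_small nm) addn0.
Qed.

Lemma digits_inj m n n' : (n < b ^ m)%N -> (n' < b ^ m)%N ->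
  (forall r, (r < m)%N -> (n %/ b ^ r %% b = n' %/ b ^ r %% b)%N) -> n = n'.
Proof.
elim: m n n' => [|m IH] n n'; first by rewrite expn0 !ltnS !leqn0 => /eqP-> /eqP->.
move=> nm nm' H; rewrite (divn_eq n b) (divn_eq n' b).
have := H 0%N isT; rewrite expn0 !divn1 => ->; congr (_ * b + _)%N.
apply: IH; rewrite ?ltn_divLR // -?expnSr // => r rm.
by rewrite -!divnMA -!expnS; exact: H.
Qed.

Variable R : realType.

Lemma truncationE d m : truncation R m d = (digits_value d m)%:R / b%:R ^+ m.
Proof.
have b0 : b%:R != 0 :> R by rewrite pnatr_eq0 -lt0n.
elim: m => [|m IH]; first by rewrite /truncation big_ord0 mul0r.
rewrite /truncation big_ord_recr /= -/(truncation R m d) IH /digit_term natrD natrM exprS.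
by field; rewrite expf_neq0 // b0.
Qed.

Lemma truncation_ge0 d m : 0 <= truncation R m d.
Proof. by rewrite truncationE divr_ge0 ?exprn_ge0 ?ler0n. Qed.

Lemma truncation_lt1 d m : truncation R m d < 1.
Proof.
rewrite truncationE ltr_pdivrMr ?exprn_gt0 ?ltr0n // mul1r -natrX ltr_nat.
exact: digits_value_lt.
Qed.

(** Without denominators, both inequalities say that a is the quotient of the m-digit numerator by
    b^(m - n), which is the n-digit numerator. *)
Lemma truncation_interval d m n a : (n <= m)%N ->
  (a%:R / b%:R ^+ n <= truncation R m d < a.+1%:R / b%:R ^+ n) = (digits_value d n == a).
Proof.
move=> nm; rewrite -(digits_value_div d n (m - n)) subnKC // truncationE.
have bX k : 0 < b%:R ^+ k :> R by rewrite exprn_gt0 ?ltr0n.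
rewrite ler_pdivrMr // mulrAC ler_pdivlMr // ltr_pdivlMr // [_ / _ * _]mulrAC ltr_pdivrMr //.
rewrite -!natrX -!natrM ler_nat ltr_nat -(subnKC nm) addKn expnD.
rewrite !mulnA ![(_ * b ^ n * _)%N]mulnAC !leq_pmul2r ?ltn_pmul2r ?expn_gt0 ?b_gt0 //.
by rewrite -leq_divRL ?expn_gt0 ?b_gt0 // -ltn_divLR ?expn_gt0 ?b_gt0 // ltnS eq_sym eqn_leq.
Qed.

Lemma series_digit_term d : series (digit_term R d) = (fun m => truncation R m d).
Proof. by apply/funext => m; rewrite seriesEord. Qed.

Lemma digit_value_bounds d : cvgn (series (digit_term R d)) /\ 0 <= digit_value R d <= 1.
Proof.
have nd : nondecreasing_seq (series (digit_term R d)).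
  apply/nondecreasing_seqP => m; rewrite series_digit_term /truncation big_ord_recr /=.
  by rewrite lerDl divr_ge0 ?exprn_ge0 ?ler0n.
have cv : cvgn (series (digit_term R d)).
  apply: nondecreasing_is_cvgn => //; exists 1 => _ [m _ <-].
  by rewrite series_digit_term ltW // truncation_lt1.
split=> //; apply/andP; split.
  have := nondecreasing_cvgn_le nd cv 0%N; apply: le_trans.
  by rewrite series_digit_term truncation_ge0.
apply: limr_le => //; apply: nearW => m.
by rewrite series_digit_term ltW // truncation_lt1.
Qed.

End Digits.

(** Translation by a preimage of a difference carries one fibre onto another, so all fibres have the
    same size. *)
Lemma card_mulmx_fiber (K : finFieldType) m n (A : 'M[K]_(m, n)) :
  (forall w : 'rV_n, exists u, u *m A = w) ->
  forall w, (#|[pred u : 'rV_m | u *m A == w]| * #|K| ^ n = #|K| ^ m)%N.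
Proof.
move=> A_surj w.
have cardE k : #|{: 'rV[K]_k}| = (#|K| ^ k)%N by rewrite card_mx mul1n.
rewrite -!cardE -[RHS]sum1_card (partition_big (fun u => u *m A) predT) //=.
rewrite (eq_bigr (fun=> #|[pred u : 'rV_m | u *m A == w]|)) => [|w' _].
  by rewrite sum_nat_const mulnC.
have [u0 u0A] := A_surj (w' - w).
rewrite (reindex_inj (addIr u0)) -sum1_card; apply: eq_bigl => u /=.
by rewrite inE mulmxDl u0A addrCA addrC -subr_eq0 addrK subr_eq0.
Qed.

(** * From independent rows to nets *)

Section DigitalNets.
Variables (K : finFieldType) (s : nat) (C : 'I_s -> nat -> nat -> K).
Variables (psi : nat -> 'I_#|K| -> K) (lambda : 'I_s -> nat -> K -> 'I_#|K|).
Hypothesis psi_bij : forall r, bijective (psi r).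
Hypothesis psi0 : exists r0, forall r (d : 'I_#|K|),
  (r0 <= r)%N -> d = 0%N :> nat -> psi r d = 0.
Hypothesis lambda_bij : forall i j, bijective (lambda i j).

Let q_gt1 : (1 < #|K|)%N. Proof. exact: finNzRing_gt1. Qed.
Let q_gt0 : (0 < #|K|)%N. Proof. exact: ltnW. Qed.

(** Within a block the digits from position m on are those of k, so each coordinate is affine in the
    images under [psi] of the m low digits. *)
Lemma digital_coord_split m k i j : exists c0 : K, forall n, (n < #|K| ^ m)%N ->
  digital_coord C psi (k * #|K| ^ m + n) i j =
    \sum_(r < m) C i j r * psi r (base_digit K n r) + c0.
Proof.
(* From position m + L on, the digits are 0 because k < q^k, and [psi] sends them to 0 because r0 is
   passed. *)
have [r0 r0P] := psi0; pose L := (r0 + k)%N.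
exists (\sum_(r < L) C i j (m + r)%N * psi (m + r)%N (base_digit K k r)) => n nm.
rewrite /digital_coord -(@fsbig_widen _ _ _ _ `I_(m + L)) //; last first.
  move=> r /= [_ /negP]; rewrite -leqNgt => mLr.
  rewrite r0P ?mulr0 //; first by move: mLr; rewrite /L; lia.
  have -> : r = (m + (r - m))%N by move: mLr; lia.
  rewrite /= digit_high // divn_small ?mod0n //.
  apply: leq_trans (ltn_expl k q_gt1) _; rewrite leq_exp2l //.
  by move: mLr; rewrite /L; lia.
rewrite -(fsbig_ord _ _ (fun r => C i j r * psi r (base_digit K (k * #|K| ^ m + n) r))).
rewrite big_split_ord /=; congr (_ + _); apply: eq_bigr => r _.
  by congr (_ * psi _ _); apply/val_inj; rewrite /= digit_low.
by congr (_ * psi _ _); apply/val_inj; rewrite /= digit_high.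
Qed.

Lemma digits_row_bij m : bijective
  (fun n : 'I_(#|K| ^ m) => \row_(r < m) psi r (base_digit K n r) : 'rV[K]_m).
Proof.
apply: inj_card_bij; last by rewrite card_mx mul1n card_ord.
move=> n n' /rowP E; apply/val_inj; apply: (digits_inj q_gt1 (ltn_ord n) (ltn_ord n')) => r rm.
by have := E (Ordinal rm); rewrite !mxE /= => /(bij_inj (psi_bij r))/(congr1 val).
Qed.

(** Lying in an elementary interval becomes a system u A = W of m - t equations for the vector u of
    images of low digits; surjectivity of A gives it q^t solutions. *)
Lemma digital_net (R : realType) t :
  (forall (d : 'I_s -> nat) m, (0 < m)%N -> (t + \sum_i d i <= m)%N ->
    forall w : 'I_s -> nat -> K, exists c : 'I_m -> K,
      forall i j, (j < d i)%N -> \sum_(r < m) c r * C i j r = w i j) ->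
  forall k m, (t < m)%N ->
    net t (fun (n : 'I_(#|K| ^ m)) i =>
      truncation R m (digital_digits C psi lambda (k * #|K| ^ m + n)%N i)).
Proof.
move=> C_surj k m tm; split=> //; first exact: ltnW.
  by move=> n i; rewrite truncation_ge0 // truncation_lt1.
move=> d a ad vol.
have sum_d : (\sum_i d i = m - t)%N.
  have b0 : (0 : R) < #|K|%:R by rewrite ltr0n.
  move: vol; rewrite prodfV prodrXr => /invr_inj /eqP.
  rewrite -!natrX eqr_nat eqn_exp2l // => /eqP.
  by [].
have dm i : (d i <= m)%N.
  by apply: leq_trans (leq_subr t m); rewrite -sum_d (bigD1 i) //= leq_addr.
have /choice[w wP] : forall i, exists w : nat -> 'I_#|K|,
  forall dg, digits_value dg (d i) = a i <-> forall j, (j < d i)%N -> dg j = w j.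
  by move=> i; exact: digits_of_value.
have /choice[c0 c0P] : forall ij : 'I_s * nat, exists c0 : K, forall n, (n < #|K| ^ m)%N ->
  digital_coord C psi (k * #|K| ^ m + n) ij.1 ij.2 =
    \sum_(r < m) C ij.1 ij.2 r * psi r (base_digit K n r) + c0.
  by move=> ij; exact: digital_coord_split.
have /choice[v vP] : forall ij : 'I_s * nat, exists v, lambda ij.1 ij.2 v = w ij.1 ij.2.
  by move=> ij; have [f _ fK] := lambda_bij ij.1 ij.2; exists (f (w ij.1 ij.2)).
pose J := {i : 'I_s & 'I_(d i)}.
have cardJ : #|{: J}| = (m - t)%N.
  by rewrite card_tagged sumnE big_map big_enum -sum_d; apply: eq_bigr => i _; rewrite card_ord.
pose A := \matrix_(r < m, x < #|{: J}|) C (tag (enum_val x)) (tagged (enum_val x)) r.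
(* Prescribed digits pulled back through [lambda], minus the constant due to the high digits. *)
pose W := \row_(x < #|{: J}|) (v (tag (enum_val x), tagged (enum_val x) : nat)
                             - c0 (tag (enum_val x), tagged (enum_val x) : nat)).
have A_surj (u : 'rV_#|{: J}|) : exists c, c *m A = u.
  (* [C_surj] expects a target for every pair of indices, so [u] is extended by 0. *)
  pose u' i j := if (insub j : option 'I_(d i)) is Some j'
    then u 0 (enum_rank (Tagged (fun i => 'I_(d i)) j')) else 0.
  have [||c cP] := C_surj d m _ _ u'; first exact: leq_ltn_trans tm.
    by rewrite sum_d subnKC // ltnW.
  exists (\row_r c r); apply/rowP => x; rewrite mxE.
  under eq_bigr do rewrite !mxE.
  rewrite cP // /u' insubT; first exact: ltn_ord.
  move=> p; rewrite -[x in RHS]enum_valK; congr (u 0 (enum_rank _)).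
  by case: (enum_val x) p => /= i j p; congr Tagged; apply/val_inj.
have /eqP : (#|[pred u | u *m A == W]| * #|K| ^ (m - t) = #|K| ^ t * #|K| ^ (m - t))%N.
  by rewrite -expnD subnKC ?(ltnW tm) // -cardJ card_mulmx_fiber.
rewrite eqn_pmul2r ?expn_gt0 ?q_gt0 // => /eqP <-.
rewrite -[LHS]sum1_card -[RHS]sum1_card [RHS](reindex _ (onW_bij _ (digits_row_bij m))).
apply: eq_bigl => n; rewrite !inE; apply/forallP/eqP => [H|H i].
  apply/rowP => x; rewrite !mxE.
  set i := tag (enum_val x); set j := tagged (enum_val x).
  have := H i; rewrite truncation_interval // => /eqP/(wP i)/(_ j (ltn_ord j)).
  rewrite -(vP (i, j : nat)) => /(bij_inj (lambda_bij i j)).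
  rewrite (c0P (i, j : nat)) // => <-; rewrite addrK.
  by apply: eq_bigr => r _; rewrite !mxE mulrC.
rewrite truncation_interval //; apply/eqP/(wP i) => j jd.
rewrite -(vP (i, j)) /digital_digits; congr lambda.
rewrite (c0P (i, j)) //=; move/rowP/(_ (enum_rank (Tagged _ (Ordinal jd) : J))): H.
rewrite !mxE enum_rankK /= => H; rewrite -[RHS](subrK (c0 (i, j))) -H; congr (_ + _).
by apply: eq_bigr => r _; rewrite !mxE enum_rankK mulrC.
Qed.

End DigitalNets.

(** * From nets to the digital sequence *)

Theorem corollary2 (R : realType)
    (* the function field and its places *)
    (K : finFieldType) (F : fieldType) (iota : {rmorphism K -> F}) (g s : nat)
    (Pinf : place iota) (P : 'I_s -> place iota)
    (F_ff : function_field iota) (K_full : full_constant_field iota)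
    (F_genus : has_genus iota g) (s_ge1 : (1 <= s)%N)
    (P_inj : injective P) (P_neq : forall i, P i != Pinf)
    (Pinf_deg : degree Pinf = 1%N)
    (* the choices and the matrices of the columnwise construction *)
    (nn : nat -> nat) (nn_enum : nongap_enumeration Pinf nn)
    (y : nat -> F)
    (y_in : forall r, riemann_roch << (nn r)%:Z *g Pinf >> (y r))
    (y_notin : forall r, ~ riemann_roch << ((nn r)%:Z - 1) *g Pinf >> (y r))
    (z : 'I_s -> F) (z_param : forall i, P i (z i) = 1)
    (Fh : forall i, completion (P i)) (E : 'I_s -> fieldExtType K)
    (tau : forall i, coefficient_field (Fh i) (E i))
    (beta : forall i, nat -> nat -> E i)
    (beta_exp : forall i r,
       local_expansion (tau i) (z i) (y r) (fun k => beta i k r))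
    (bas : forall i, (degree (P i)).-tuple (E i))
    (bas_basis : forall i, basis_of fullv (bas i))
    (C : 'I_s -> nat -> nat -> K)
    (C_def : forall i k (h : 'I_(degree (P i))) r,
       C i (k * degree (P i) + h)%N r = coord (bas i) h (beta i k r))
    (* the choices of the digital method *)
    (psi : nat -> 'I_#|K| -> K) (psi_bij : forall r, bijective (psi r))
    (psi0 : exists r0, forall r (d : 'I_#|K|),
       (r0 <= r)%N -> d = 0%N :> nat -> psi r d = 0)
    (lambda : 'I_s -> nat -> K -> 'I_#|K|)
    (lambda_bij : forall i j, bijective (lambda i j)) :
  ts_sequence (g + \sum_(i < s) (degree (P i) - 1))%N
    (digital_sequence R C psi lambda) (digital_digits C psi lambda).
Proof.
have q_gt1 : (1 < #|K|)%N by exact: finNzRing_gt1.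
split=> // [n i|n i|].
- by have [_] := digit_value_bounds q_gt1 R (digital_digits C psi lambda n i).
- by have [cv _] := digit_value_bounds q_gt1 R (digital_digits C psi lambda n i).
move=> k m tm; apply: (digital_net psi_bij psi0 lambda_bij) => // d m' m'0 le_m'.
by apply: (rows_surjective F_genus Pinf_deg nn_enum y_in y_notin P_inj P_neq
  z_param beta_exp bas_basis C_def).
Qed.
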